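(* Let $d\ge 2$ and let $\mu$ be a non-degenerate probability measure on $\mathbf{F}_d$ with finite first moment. Then there exists a sequence of marked groups $\left((\Gamma_n,S_n)\right)_{n=1}^\infty$ in $\mathcal{G}_d$ such that: (i) the sequence $(\Gamma_n,S_n)$ converges to $(\mathbf{F}_d,\mathbf{S})$ as $n\to\infty$ in the space $\mathcal{G}_d$ of $d$-marked groups; (ii) the asymptotic entropies satisfy $h(\Gamma_n,\mu)\to 0$ as $n\to\infty$; (iii) for each $n\in\mathbb{N}$, $\Gamma_n$ is non-amenable, has no nontrivial amenable normal subgroups, and has only countably many amenable subgroups.
   Context: $\mathbf{F}_d$ is the free group of rank $d$ and $\mathbf{S}=(\mathbf{s}_1,\dots,\mathbf{s}_d)$ is its free generating tuple. A probability measure $\mu$ on a countable group is non-degenerate if its support generates the group as a semigroup; it has finite first moment on $\mathbf{F}_d$ if $\sum_{g}|g|_{\mathbf{S}}\,\mu(g)<\infty$, with $|\cdot|_{\mathbf S}$ the word length. $\mathcal{G}_d$ is the space of $d$-marked groups $(G,S)$, where $S=(s_1,\dots,s_d)$ is a generating tuple of the group $G$, with the Cayley–Grigorchuk topology: two marked groups are close if the marked balls of large radius around the identity in their Cayley graphs are isomorphic (as labelled rooted graphs). A marked group $(G,(s_1,\dots,s_d))$ is regarded as a quotient of $\mathbf{F}_d$ through the epimorphism $\mathbf{s}_i\mapsto s_i$; $h(G,\mu)$ denotes the asymptotic entropy $\lim_{m\to\infty}\frac1m H(\bar\mu^{(m)})$ of the pushforward $\bar\mu$ of $\mu$ to $G$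 under this epimorphism, where $\bar\mu^{(m)}$ is the $m$-fold convolution power and $H$ is Shannon entropy. *)

(* Defs.v *)
From HB Require Import structures.
From mathcomp Require Import all_boot all_order all_algebra.
From mathcomp Require Import all_classical all_reals all_analysis.

Set Implicit Arguments.
Unset Strict Implicit.
Unset Printing Implicit Defensive.

Import Order.TTheory GRing.Theory Num.Theory.
Local Open Scope classical_set_scope.
Local Open Scope group_scope.

(** * Words and free groups *)

(* The letter [(i, false)] stands for the i-th generator and [(i, true)] for
   its inverse. *)
Definition letter (d : nat) : Type := 'I_d * bool.

Definition letter_inv (d : nat) (l : letter d) : letter d := (l.1, ~~ l.2).

Definition letter_eval (G : groupType) (d : nat) (s : 'I_d -> G)
  (l : letter d) : G := if l.2 then (s l.1)^-1 else s l.1.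

Definition word_eval (G : groupType) (d : nat) (s : 'I_d -> G)
  (w : seq (letter d)) : G := \prod_(l <- w) letter_eval s l.

Definition reduced (d : nat) (w : seq (letter d)) : bool :=
  sorted (fun l l' : letter d => l' != letter_inv l) w.

(* Left multiplication of a reduced word by a letter. *)
Definition push (d : nat) (l : letter d) (w : seq (letter d)) :=
  if w is l' :: w' then if l' == letter_inv l then w' else l :: w else [:: l].

Lemma letter_invK d : involutive (@letter_inv d).
Proof. by case=> i b; rewrite /letter_inv /= negbK. Qed.

Lemma reduced_push d (l : letter d) w : reduced w -> reduced (push l w).
Proof.
case: w => [|l' w] //= red_w; case: ifPn => [_|l'l]; first exact: path_sorted red_w.
by rewrite /reduced /= l'l.
Qed.

Lemma reduced_act d (u v : seq (letter d)) :
  reduced v -> reduced (foldr (@push d) v u).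
Proof. by move=> red_v; elim: u => //= l u; exact: reduced_push. Qed.

Lemma pushK d (l : letter d) w : reduced w -> push (letter_inv l) (push l w) = w.
Proof.
case: w => [|l' w]; first by rewrite /= letter_invK eqxx.
rewrite /push; case: (eqVneq l' (letter_inv l)) => [->|l'l] red_w; last first.
  by rewrite letter_invK eqxx.
case: w red_w => [|l2 w] //=; rewrite /reduced /= => /andP[].
by move/negPf ->.
Qed.

Lemma act_push d (l : letter d) u w : reduced w ->
  foldr (@push d) w (push l u) = push l (foldr (@push d) w u).
Proof.
case: u => [|l' u] //= red_w; case: eqVneq => [->|//].
by rewrite -{1}[l]letter_invK pushK//; exact: reduced_act.
Qed.

Lemma act_reduced d (w : seq (letter d)) :
  reduced w -> foldr (@push d) [::] w = w.
Proof.
elim: w => //= l w IHw red_lw; rewrite (IHw (path_sorted red_lw)).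
by case: w red_lw {IHw} => [|l' w] //; rewrite /reduced /= => /andP[/negPf ->].
Qed.

Lemma act_inv d (u v : seq (letter d)) : reduced v ->
  foldr (@push d) (foldr (@push d) v u) (rev (map (@letter_inv d) u)) = v.
Proof.
move=> red_v; elim: u => [|l u IHu] //=.
by rewrite rev_cons foldr_rcons pushK ?IHu//; exact: reduced_act.
Qed.

Lemma reduced_inv d (w : seq (letter d)) :
  reduced w -> reduced (rev (map (@letter_inv d) w)).
Proof.
rewrite /reduced rev_sorted sorted_map; apply: sub_sorted => l l'.
by apply: contra => /= /eqP /(can_inj (@letter_invK d)) ->; rewrite letter_invK.
Qed.

Record free_group (d : nat) := FreeGroup {
  fg_word :> seq (letter d);
  fg_reduced : reduced fg_word
}.

HB.instance Definition _ d := [isSub for @fg_word d].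
HB.instance Definition _ d := [Countable of free_group d by <:].

Section FreeGroupLaw.
Variable d : nat.
Implicit Types x y z : free_group d.

Definition fg_one : free_group d := @FreeGroup d [::] isT.

Definition fg_mul x y : free_group d :=
  FreeGroup (reduced_act x (fg_reduced y)).

Definition fg_inv x : free_group d := FreeGroup (reduced_inv (fg_reduced x)).

Fact fg_mulA : associative fg_mul.
Proof.
move=> x y z; apply: val_inj => /=; elim: (fg_word x) => //= l u ->.
by rewrite act_push//; exact: fg_reduced.
Qed.

Fact fg_mul1 : left_id fg_one fg_mul.
Proof. by move=> x; exact: val_inj. Qed.

Fact fg_mulr1 : right_id fg_one fg_mul.
Proof. by move=> x; apply: val_inj; rewrite /= act_reduced ?fg_reduced. Qed.

Fact fg_mulV : left_inverse fg_one fg_inv fg_mul.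
Proof.
move=> x; apply: val_inj => /=.
by rewrite -{1}(act_reduced (fg_reduced x)) act_inv.
Qed.

Fact fg_mulrV : right_inverse fg_one fg_inv fg_mul.
Proof.
move=> x; rewrite -[LHS]fg_mul1 -(fg_mulV (fg_inv x)).
by rewrite -fg_mulA [fg_mul (fg_inv x) _]fg_mulA fg_mulV fg_mul1.
Qed.

HB.instance Definition _ := isGroup.Build (free_group d)
  fg_mulA fg_mul1 fg_mulr1 fg_mulV fg_mulrV.

HB.instance Definition _ := isPointed.Build (free_group d) 1.

HB.instance Definition _ := @isMeasurable.Build default_measure_display
  (free_group d) discrete_measurable discrete_measurable0
  discrete_measurableC discrete_measurableU.

Definition fg_gen (i : 'I_d) : free_group d := @FreeGroup d [:: (i, false)] isT.

End FreeGroupLaw.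

(** * Subgroups, generation, amenability *)

Definition is_subgroup (G : groupType) (H : set G) : Prop :=
  group_closed (mem H).

Definition is_normal (G : groupType) (H : set G) : Prop :=
  forall x y : G, H x -> H (x ^ y).

Definition generates (G : groupType) (d : nat) (s : 'I_d -> G) : Prop :=
  smallest (@is_subgroup G) (range s) = setT.

Definition semigroup_generates (G : groupType) (A : set G) : Prop :=
  smallest (fun B : set G => mulg_closed (mem B)) A = setT.

(* Amenability of the subgroup [H], as a discrete group: there is a finitely
   additive left-invariant probability measure on all subsets of [H]. *)
Definition amenable (R : realType) (G : groupType) (H : set G) : Prop :=
  exists m : set G -> R,
    [/\ forall A, A `<=` H -> (0 <= m A)%R,
        m H = 1%R,
        forall A B, A `<=` H -> B `<=` H -> A `&` B = set0 ->
          m (A `|` B) = (m A + m B)%R &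
        forall h A, H h -> A `<=` H -> m [set h * x | x in A] = m A].

(** * Marked groups *)

Lemma word_eval_nil (G : groupType) d (s : 'I_d -> G) : word_eval s [::] = 1.
Proof. by rewrite /word_eval big_nil. Qed.

Lemma word_eval_cons (G : groupType) d (s : 'I_d -> G) l w :
  word_eval s (l :: w) = letter_eval s l * word_eval s w.
Proof. by rewrite /word_eval big_cons. Qed.

Lemma word_eval_cat (G : groupType) d (s : 'I_d -> G) v w :
  word_eval s (v ++ w) = word_eval s v * word_eval s w.
Proof. by rewrite /word_eval big_cat. Qed.

Lemma letter_eval_inv (G : groupType) d (s : 'I_d -> G) l :
  letter_eval s (letter_inv l) = (letter_eval s l)^-1.
Proof. by case: l => i [] //=; rewrite /letter_eval /= invgK. Qed.

Lemma word_eval_inv (G : groupType) d (s : 'I_d -> G) w :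
  word_eval s (rev (map (@letter_inv d) w)) = (word_eval s w)^-1.
Proof.
elim: w => [|l w IHw]; first by rewrite word_eval_nil invg1.
rewrite /= rev_cons -cats1 word_eval_cat IHw !word_eval_cons word_eval_nil.
by rewrite mulg1 letter_eval_inv invgM.
Qed.

Lemma generatesP (G : groupType) d (s : 'I_d -> G) :
  generates s <-> forall g, exists w, word_eval s w = g.
Proof.
split=> [gen_s g|eval_s].
  have : smallest (@is_subgroup G) (range s) g by rewrite gen_s.
  move=> /(_ [set h | exists w, word_eval s w = h]); apply; split.
    split; first by apply/mem_set; exists [::]; exact: word_eval_nil.
    move=> _ _ /set_mem[v <-] /set_mem[w <-]; apply/mem_set.
    exists (v ++ rev (map (@letter_inv d) w)).
    by rewrite word_eval_cat word_eval_inv.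
  move=> _ [i _ <-]; exists [:: (i, false)].
  by rewrite word_eval_cons word_eval_nil mulg1.
apply/seteqP; split=> // g _ H [sgH sH]; have [w <-] := eval_s g.
elim: w => [|l w IHw]; first by rewrite word_eval_nil; apply/set_mem; case: sgH.
rewrite word_eval_cons; apply/set_mem; apply: (group_closedM sgH).
  have Hs : s l.1 \in mem H by apply/mem_set/sH; exists l.1.
  by rewrite /letter_eval; case: ifP => // _; exact: (group_closedV sgH).
exact/mem_set.
Qed.

Record marked_group (d : nat) := MarkedGroup {
  mg_group :> groupType;
  mg_gen : 'I_d -> mg_group;
  mg_generates : generates mg_gen
}.

Lemma fg_word_eval d (x : free_group d) : word_eval (@fg_gen d) (fg_word x) = x.
Proof.
have evalE w : fg_word (word_eval (@fg_gen d) w) = foldr (@push d) [::] w.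
  elim: w => [|l w IHw]; first by rewrite word_eval_nil.
  rewrite word_eval_cons /= -IHw.
  by case: l => i [].
by apply: val_inj; rewrite /= evalE act_reduced ?fg_reduced.
Qed.

Fact fg_generates d : generates (@fg_gen d).
Proof. by apply/generatesP => g; exists (fg_word g); exact: fg_word_eval. Qed.

Definition free_marked_group (d : nat) : marked_group d :=
  MarkedGroup (@fg_generates d).

Section MarkedGroupTheory.
Variables (d : nat) (M : marked_group d).

(* The epimorphism from the free group onto [M] that maps [fg_gen i] to
   [mg_gen i]. *)
Definition marking (x : free_group d) : M := word_eval (@mg_gen d M) (fg_word x).

Lemma marking_gen i : marking (fg_gen i) = mg_gen M i.
Proof. by rewrite /marking word_eval_cons word_eval_nil mulg1. Qed.

Lemma marking_word w :
  word_eval (@mg_gen d M) (foldr (@push d) [::] w) = word_eval (@mg_gen d M) w.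
Proof.
elim: w => //= l w IHw; rewrite word_eval_cons -{}IHw.
case: (foldr _ _ _) => [|l' u] /=; first by rewrite word_eval_cons.
case: eqVneq => [->|_]; last by rewrite word_eval_cons.
by rewrite word_eval_cons letter_eval_inv mulVKg.
Qed.

Lemma marking_eval w : marking (word_eval (@fg_gen d) w) = word_eval (@mg_gen d M) w.
Proof.
rewrite -[RHS]marking_word /marking; congr word_eval.
elim: w => [|l w IHw]; first by rewrite word_eval_nil.
by rewrite word_eval_cons /= -IHw; case: l => i [].
Qed.

Lemma markingM : {morph marking : x y / x * y}.
Proof.
move=> x y; rewrite -{1}[x]fg_word_eval -{1}[y]fg_word_eval -word_eval_cat.
by rewrite marking_eval word_eval_cat.
Qed.

Lemma marking1 : marking 1 = 1. Proof. exact: word_eval_nil. Qed.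

HB.instance Definition _ := isMultiplicative.Build (free_group d) M marking markingM.
HB.instance Definition _ :=
  Multiplicative_isUMagmaMorphism.Build (free_group d) M marking marking1.

Lemma marking_surj : range marking = setT.
Proof.
apply/seteqP; split=> // g _; have [w <-] := (generatesP _).1 (@mg_generates d M) g.
by exists (word_eval (@fg_gen d) w); rewrite ?marking_eval.
Qed.

Fact word_length_subproof (g : M) :
  exists n, `[< exists2 w, size w = n & word_eval (@mg_gen d M) w = g >].
Proof.
have [w wE] := (generatesP _).1 (@mg_generates d M) g.
by exists (size w); apply/asboolP; exists w.
Qed.

Definition word_length (g : M) : nat := ex_minn (word_length_subproof g).

Definition ball (r : nat) : set M := [set g | (word_length g <= r)%N].

Lemma ballP r g : ball r g <->
  exists2 w, (size w <= r)%N & word_eval (@mg_gen d M) w = g.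
Proof.
rewrite /ball /= /word_length; case: ex_minnP => n /asboolP[w <- <-] n_min.
split=> [wr|[v vr vw]]; first by exists w.
by apply: leq_trans (n_min _ _) vr; apply/asboolP; exists v.
Qed.

End MarkedGroupTheory.

(* The balls of radius [r] of the two Cayley graphs (edges from [x] to
   [x * s_i] labelled by [i]) are isomorphic as rooted labelled graphs. *)
Definition ball_iso (d r : nat) (M N : marked_group d) : Prop :=
  exists f : M -> N,
    [/\ f 1 = 1,
        set_bij (@ball d M r) (@ball d N r) f &
        forall i x y, ball r x -> ball r y ->
          (y = x * mg_gen M i <-> f y = f x * mg_gen N i)].

Lemma ball_iso_refl d r (M : marked_group d) : ball_iso r M M.
Proof.
exists id; split=> //; split=> // x xr; by exists x.
Qed.

Lemma ball_iso_trans d r (M N K : marked_group d) :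
  ball_iso r M N -> ball_iso r N K -> ball_iso r M K.
Proof.
move=> [f [f1 fbij fE]] [g [g1 gbij gE]]; exists (g \o f); split.
- by rewrite /= f1.
- have [fball finj fsurj] := fbij; have [gball ginj gsurj] := gbij; split.
  + by move=> x /fball/gball.
  + move=> x y xr yr gfxy; apply: finj => //; apply: ginj => //.
      by apply/mem_set/fball/set_mem.
    by apply/mem_set/fball/set_mem.
  + by move=> z /gsurj[y /fsurj[x xr <-] <-]; exists x.
- have [fball _ _] := fbij.
  by move=> i x y xr yr; rewrite fE// gE//; exact: fball.
Qed.

Lemma ball_iso_eval d r (M N : marked_group d) (f : M -> N) : f 1 = 1 ->
  (forall i x y, ball r x -> ball r y ->
    (y = x * mg_gen M i -> f y = f x * mg_gen N i)) ->
  forall w, (size w <= r)%N ->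
    f (word_eval (@mg_gen d M) w) = word_eval (@mg_gen d N) w.
Proof.
move=> f1 fE; elim/last_ind => [|w l IHw]; first by rewrite !word_eval_nil.
rewrite size_rcons => wr; have {}IHw := IHw (ltnW wr).
have wb : ball r (word_eval (@mg_gen d M) w) by apply/ballP; exists w => //; exact: ltnW.
have wlb : ball r (word_eval (@mg_gen d M) (rcons w l)).
  by apply/ballP; exists (rcons w l); rewrite ?size_rcons.
move: wlb; rewrite -cats1 !word_eval_cat !word_eval_cons !word_eval_nil !mulg1.
case: l => i [] /=; rewrite /letter_eval /= => wlb; last first.
  by rewrite (fE _ _ _ wb wlb erefl) IHw.
have := fE i _ _ wlb wb; rewrite mulgVK IHw => /(_ erefl) ->.
by rewrite mulgK.
Qed.

Lemma ball_iso_le d r r' (M N : marked_group d) :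
  (r <= r')%N -> ball_iso r' M N -> ball_iso r M N.
Proof.
move=> rr' [f [f1 [fball finj fsurj] fE]]; exists f.
have sub_ball x : @ball d M r x -> @ball d M r' x.
  by rewrite /ball /= => xr; exact: leq_trans xr rr'.
have feval := ball_iso_eval f1 (fun i x y xr yr => (fE i x y xr yr).1).
split=> //; last by move=> i x y /sub_ball xr /sub_ball yr; exact: fE.
split.
- move=> _ /ballP[w wr <-]; apply/ballP; exists w => //.
  by rewrite feval// (leq_trans wr).
- move=> x y /set_mem/sub_ball xr /set_mem/sub_ball yr.
  by apply: finj; exact/mem_set.
- move=> _ /ballP[w wr <-]; exists (word_eval (@mg_gen d M) w).
    by apply/ballP; exists w.
  by rewrite feval// (leq_trans wr).
Qed.

(* The Cayley-Grigorchuk topology. The type [marked_group d] lives in a universe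
   too large to carry an instance of [topologicalType], hence the explicit
   open sets. *)
Definition marked_open (d : nat) (U : marked_group d -> Prop) : Prop :=
  forall M, U M -> exists r : nat, forall N, ball_iso r M N -> U N.

Definition marked_cvg (d : nat) (Gamma : nat -> marked_group d)
    (M : marked_group d) : Prop :=
  forall U : marked_group d -> Prop, marked_open U -> U M ->
    \forall n \near \oo, U (Gamma n).

Lemma marked_cvgP d (Gamma : nat -> marked_group d) M :
  marked_cvg Gamma M <-> forall r, \forall n \near \oo, ball_iso r M (Gamma n).
Proof.
split=> [GM r|GM U oU /oU[r rU]]; last by apply: filterS (GM r) => n; exact: rU.
apply: GM; last exact: ball_iso_refl.
by move=> N MN; exists r => K; exact: ball_iso_trans.
Qed.

(** * Random walks and entropy *)

Section Entropy.
Variables (R : realType) (G : groupType).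
Implicit Types p q : G -> R.

(* Measures on a countable group are given by their mass functions. *)
Definition convolution p q : G -> R :=
  fun g => fine (\esum_(h in [set: G]) (p h * q (h^-1 * g)%g)%:E)%R.

Definition convolution_power p (m : nat) : G -> R :=
  iter m (convolution p) (fun g => ((g == 1%g)%:R)%R).

(* [ln] is total, and a zero mass contributes [0 * ln 0 = 0]. *)
Definition shannon_entropy p : \bar R :=
  (\esum_(g in [set: G]) (- (p g * ln (p g)))%:E)%R.

Definition entropy_rate p (m : nat) : \bar R :=
  ((m%:R^-1)%:E * shannon_entropy (convolution_power p m))%E.

End Entropy.

Section FreeGroupMeasure.
Variables (R : realType) (d : nat) (mu : probability (free_group d) R).

Definition non_degenerate : Prop :=
  semigroup_generates [set g : free_group d | (0 < mu [set g])%E].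

Definition finite_first_moment : Prop :=
  ((\esum_(g in [set: free_group d])
      ((word_length (g : free_marked_group d))%:R%:E * mu [set g])%E)%R < +oo)%E.

(* The mass function of the image of [mu] under [marking M]. *)
Definition marked_mass (M : marked_group d) : M -> R :=
  fun g => fine (mu (@marking d M @^-1` [set g])).

Definition asymptotic_entropy (M : marked_group d) : \bar R :=
  limn (entropy_rate (@marked_mass M)).

End FreeGroupMeasure.

(* Main.v *)
Require Import Defs.
From HB Require Import structures.
From mathcomp Require Import all_boot all_order all_algebra perm.
From mathcomp Require Import all_classical all_reals all_analysis.
From mathcomp Require Import zify ring lra.

Set Implicit Arguments.
Unset Strict Implicit.
Unset Printing Implicit Defensive.
Import Order.TTheory GRing.Theory Num.Theory.
Import numFieldNormedType.Exports.
Local Open Scope classical_set_scope.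

(** The group [Gamma n] is the image of the free group in a wreath product
    [wreath X (tower k)] over a finite set [X]. Only [X] matters for the
    convergence, and, once [X] is chosen, [k] makes the entropy small.

    The set [X] is the ball of radius [2 n + 1] in the Cayley tree of the free group,
    on which the generators act by left multiplication, suitably closed up at the
    boundary. Short nontrivial words move the centre, so they survive in [Gamma n]
    ([ball_faithful]) and the balls of radius [n] are those of the free group
    ([free_ball_iso]).

    The group [tower k] is a virtual product of free groups, obtained by stopping
    after [k] steps the recursion that defines the Grigorchuk group, with a virtually
    free group containing a free group of rank two in place of the limit. An element
    has as its cost the sum of the lengths of its coordinates in the free group. By
    the contraction argument for the Grigorchuk group, with suitable weights on the
    letters, each step multiplies the cost of a long word by at most 9/10
    ([tower_cost_contract]). In [Gamma n] the cost is therefore at most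
    [eps * length + constant], where [eps] is as small as desired when [k] is large
    ([ball_cost]).

    The sum of [q ^ cost] over the whole wreath product is finite for some [q < 1]
    ([wreath_summable_cost]). By Gibbs' inequality the entropy of the [m]-th
    convolution power is then at most [- ln q] times the expected cost, plus a
    constant, and the expected length is at most [m] times the first moment. Dividing
    by [m], the asymptotic entropy is at most a constant times [eps]
    ([entropy_rate_small]); the limit exists by Fekete's lemma, because the entropy of
    a convolution is subadditive ([shannonM]).

    In a free group, powers of an element push an invariant mean towards the two ends
    of its axis, so that two elements of an amenable subgroup share an end and
    amenable subgroups are cyclic ([amenable_cyclic]). Hence the amenable subgroups of
    iterated wreath products of free groups over finite sets are finitely generated
    ([wreath_amenable_fg]), and [Gamma n] has countably many of them.

    A subset [S] of a group is called rigid here when it normalizes no nontrivial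
    amenable subgroup. If a set of elements of a wreath product contains, for each
    point and each element of a rigid set, the element having that single lamp, then
    it is rigid ([wreath_rigid]). Elements with a single lamp come at each level of
    the tower from the branch structure of the Grigorchuk group ([branch_at]), and at
    the last level from an odd power of a generator ([single_lamp]): this power acts
    trivially on the ball, and its lamps, of order two, sit at a single boundary loop.
    So [Gamma n] is rigid in itself: it has no nontrivial amenable normal subgroup,
    and, being nontrivial, it is not amenable. *)

(** * Subgroups and invariant means *)

Section Subgroups.
Variable G : groupType.
Implicit Types (H N : set G) (x y : G).
Local Open Scope group_scope.

Lemma is_subgroupP H : is_subgroup H <->
  [/\ H 1, forall x y, H x -> H y -> H (x * y) & forall x, H x -> H x^-1].
Proof.
split=> [[H1 HF]|[H1 HM HV]]; last first.
  split; first exact/mem_set.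
  by move=> x y /set_mem Hx /set_mem Hy; apply/mem_set/HM/HV.
have {}H1 : H 1 by exact/set_mem.
have {}HF x y : H x -> H y -> H (x / y).
  by move=> Hx Hy; apply/set_mem/HF; exact/mem_set.
have HV x : H x -> H x^-1 by move=> Hx; rewrite -[x^-1]mul1g; exact: HF.
by split=> // x y Hx /HV Hy; rewrite -[y]invgK; exact: HF.
Qed.

Lemma subgroup1 H : is_subgroup H -> H 1.
Proof. by case/is_subgroupP. Qed.

Lemma subgroupM H x y : is_subgroup H -> H x -> H y -> H (x * y).
Proof. by case/is_subgroupP => _ + _; exact. Qed.

Lemma subgroupV H x : is_subgroup H -> H x -> H x^-1.
Proof. by case/is_subgroupP => _ _; exact. Qed.

Lemma subgroupX H x n : is_subgroup H -> H x -> H (x ^+ n).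
Proof.
move=> sgH Hx; elim: n => [|n IHn]; first by rewrite expg0; exact: subgroup1.
by rewrite expgS; exact: subgroupM.
Qed.

Lemma subgroup_setI H N : is_subgroup H -> is_subgroup N -> is_subgroup (H `&` N).
Proof.
case/is_subgroupP => H1 HM HV /is_subgroupP[N1 NM NV].
apply/is_subgroupP; split=> //.
- by move=> x y [Hx Nx] [Hy Ny]; split; [exact: HM|exact: NM].
- by move=> x [Hx Nx]; split; [exact: HV|exact: NV].
Qed.

End Subgroups.

(** Partial homomorphisms: the coordinates of a wreath product are multiplicative
    only on stabilisers. *)
Definition morph_on (G G' : groupType) (H : set G) (phi : G -> G') : Prop :=
  forall x y, H x -> H y -> phi (x * y)%g = (phi x * phi y)%g.

Section MorphOn.
Variables (G G' : groupType) (H : set G) (phi : G -> G').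
Hypotheses (sgH : is_subgroup H) (phiM : morph_on H phi).
Local Open Scope group_scope.

Lemma morph_on1 : phi 1 = 1.
Proof.
have H1 := subgroup1 sgH; have := phiM H1 H1; rewrite mulg1 => /esym.
by rewrite -[X in _ = X]mulg1 => /mulgI.
Qed.

Lemma morph_onV x : H x -> phi x^-1 = (phi x)^-1.
Proof.
move=> Hx; apply/esym/mulg1_eq; rewrite -phiM//; last exact: subgroupV.
by rewrite mulgV morph_on1.
Qed.

Lemma subgroup_image : is_subgroup (phi @` H).
Proof.
apply/is_subgroupP; split.
- by exists 1; [exact: subgroup1|exact: morph_on1].
- move=> _ _ [x Hx <-] [y Hy <-]; exists (x * y); last exact: phiM.
  exact: subgroupM.
- move=> _ [x Hx <-]; exists x^-1; last exact: morph_onV.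
  exact: subgroupV.
Qed.

Lemma subgroup_ker : is_subgroup (H `&` [set x | phi x = 1]).
Proof.
apply/is_subgroupP; split => /=.
- by split; [exact: subgroup1|exact: morph_on1].
- move=> x y [Hx x1] [Hy y1]; split; first exact: subgroupM.
  by rewrite phiM// x1 y1 mulg1.
- move=> x [Hx x1]; split; first exact: subgroupV.
  by rewrite morph_onV// x1 invg1.
Qed.

End MorphOn.

Section Means.
Variables (R : realType) (G : groupType).
Implicit Types (H : set G) (m : set G -> R).
Local Open Scope group_scope.

Definition is_mean H m : Prop :=
  [/\ forall A, A `<=` H -> (0 <= m A)%R,
      m H = 1%R,
      forall A B, A `<=` H -> B `<=` H -> A `&` B = set0 ->
        m (A `|` B) = (m A + m B)%R &
      forall h A, H h -> A `<=` H -> m [set h * x | x in A] = m A].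

Lemma mean_set0 H m : is_mean H m -> m set0 = 0%R.
Proof.
case=> _ _ mU _; have := mU set0 set0 (sub0set _) (sub0set _) (set0I _).
by rewrite set0U => /eqP; rewrite -subr_eq subrr => /eqP.
Qed.

Lemma mean_le H m A B : is_mean H m -> A `<=` B -> B `<=` H -> (m A <= m B)%R.
Proof.
move=> [m0 m1 mU mt] AB BH.
have BA : B `\` A `<=` H by move=> x [/BH].
have AH : A `<=` H by exact: subset_trans BH.
rewrite -(setDUK AB) mU//; first by rewrite lerDl; exact: m0.
by apply/seteqP; split => // x [Ax [_]].
Qed.

Lemma mean_le1 H m A : is_mean H m -> A `<=` H -> (m A <= 1)%R.
Proof.
by move=> mm AH; have [_ <- _ _] := mm; exact: mean_le mm AH _.
Qed.

Lemma mean_setU_le H m A B : is_mean H m -> A `<=` H -> B `<=` H ->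
  (m (A `|` B) <= m A + m B)%R.
Proof.
move=> mm AH BH; have [m0 m1 mU mt] := mm.
have BA : B `\` A `<=` H by move=> x [/BH].
have -> : A `|` B = A `|` (B `\` A).
  by apply/seteqP; split=> x; rewrite /setU /setD /=; case: (pselect (A x)); tauto.
rewrite mU//; last by apply/seteqP; split => // x [Ax [_]].
by rewrite lerD2l; apply: mean_le mm _ BH => x [].
Qed.

(** A wandering set is null: its disjoint translates all have the same mean,
    and their means add up to at most one. *)
Lemma mean_wandering H m (h : G) A : is_subgroup H -> is_mean H m -> H h ->
  A `<=` H -> (forall n x, A x -> ~ A (h ^+ n.+1 * x)) -> m A = 0%R.
Proof.
move=> sgH mm Hh AH wand; have [m0 m1 mU mt] := mm.
pose U n := [set x | exists i y, [/\ (i < n)%N, A y & x = h ^+ i * y]].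
have UH n : U n `<=` H.
  by move=> _ [i [y [_ Ay ->]]]; apply: subgroupM (AH _ Ay) => //; exact: subgroupX.
have mUn n : m (U n) = (n%:R * m A)%R.
  elim: n => [|n IHn].
    rewrite mul0r -(mean_set0 mm); congr m.
    by apply/seteqP; split => // x [i [y []]].
  have -> : U n.+1 = A `|` [set h * x | x in U n].
    apply/seteqP; split => x.
      move=> [[|i] [y [ilt Ay ->]]]; first by left; rewrite expg0 mul1g.
      by right; exists (h ^+ i * y); [exists i, y|rewrite expgS mulgA].
    move=> [Ax|[_ [i [y [ilt Ay ->]]] <-]].
      by exists 0%N, x; rewrite expg0 mul1g.
    by exists i.+1, y; rewrite expgS mulgA.
  rewrite mU//.
  - by rewrite mt// IHn mulrSr mulrDl mul1r addrC.
  - by move=> _ [x /UH Hx <-]; exact: subgroupM.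
  - apply/seteqP; split => // x [Ax [_ [i [y [_ Ay ->]]] xE]].
    by move: Ax; rewrite -xE mulgA -expgS; exact: wand.
have [mA|] := leP (m A) 0%R; first by apply/le_anti; rewrite mA m0.
move=> mA; pose n := (Num.truncn (m A)^-1).+1.
have := mean_le1 mm (UH n); rewrite mUn -ler_pdivlMr// mul1r leNgt.
by rewrite /n truncnS_gt.
Qed.

Lemma amenable_sub (H N : set G) : is_subgroup H -> is_subgroup N -> N `<=` H ->
  amenable R H -> amenable R N.
Proof.
move=> sgH sgN NH [m [m0 m1 mU mt]].
(* [r h] represents the coset [N h], and a subset [A] of [N] is thickened to
   the union of the [A k], for [k] a representative. *)
pose r h := xget 1 [set k | N (h * k^-1)].
have rP h : N (h * (r h)^-1).
  apply: (@xgetPex _ _ [set k | N (h * k^-1)]); exists h => /=.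
  by rewrite mulgV; exact: subgroup1.
have rM n h : N n -> r (n * h) = r h.
  move=> Nn; congr xget; apply/seteqP; split => k /=.
    by rewrite -mulgA => /(subgroupM sgN (subgroupV sgN Nn)); rewrite mulKg.
  by rewrite -mulgA; exact: subgroupM.
pose T A := [set h | H h /\ A (h * (r h)^-1)].
have TH A : T A `<=` H by move=> h [].
exists (fun A => m (T A)); split => [A AN||A B AN BN AB|n A Nn AN].
- exact/m0/TH.
- by rewrite -[RHS]m1; congr m; apply/seteqP; split => // h Hh; split.
- rewrite -mU//; first by congr m; apply/seteqP; split=> h; rewrite /T /setU /=; tauto.
  apply/seteqP; split => // h [[_ Ah] [_ Bh]].
  have : (A `&` B) (h * (r h)^-1) by [].
  by rewrite AB.
- rewrite -(mt n (T A))//; last exact: NH.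
  congr m; apply/seteqP; split => h.
    move=> [Hh [k Ak kE]]; exists (n^-1 * h); last by rewrite mulVKg.
    split; first by apply: subgroupM => //; apply/(subgroupV sgH)/NH.
    by rewrite rM; [rewrite -mulgA -kE mulKg|exact: subgroupV].
  move=> [k [Hk Ak] <-]; split; first by apply: subgroupM => //; exact: NH.
  by exists (k * (r k)^-1) => //; rewrite rM// mulgA.
Qed.

End Means.

Lemma amenable_image (R : realType) (G G' : groupType) (H : set G)
    (phi : G -> G') : is_subgroup H -> morph_on H phi ->
  amenable R H -> amenable R (phi @` H).
Proof.
move=> sgH phiM [m [m0 m1 mU mt]].
have sub A : H `&` phi @^-1` A `<=` H by move=> x [].
exists (fun A => m (H `&` phi @^-1` A)); split => [A AH||A B AH BH AB|h A [k Hk <-] AH].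
- exact/m0/sub.
- by rewrite -[RHS]m1; congr m; apply/seteqP; split => [x []//|x Hx]; split => //; exists x.
- rewrite preimage_setU setIUr mU//; apply/seteqP; split => // x [[_ Ax] [_ Bx]].
  by have : (A `&` B) (phi x) by []; rewrite AB.
- rewrite -(mt k (H `&` phi @^-1` A))//; congr m; apply/seteqP; split => x.
    move=> [Hx [y Ay yE]].
    have Hkx : H (k^-1 * x)%g by apply: subgroupM => //; exact: subgroupV.
    exists (k^-1 * x)%g; last by rewrite mulVKg.
    split => //=; have -> // : phi (k^-1 * x)%g = y.
    apply: (@mulgI _ (phi k)); rewrite yE -phiM// mulVKg//.
  move=> [y [Hy Ay] <-]; split; first exact: subgroupM.
  by exists (phi y) => //; rewrite phiM.
Qed.
(** * Amenable subgroups of free groups are cyclic *)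

Section FreeGroupRays.
Variable d : nat.
Implicit Types (x y z g : free_group d) (u v w : seq (letter d)).
Local Open Scope group_scope.

Let F := free_group d.
Let ev (w : seq (letter d)) : F := word_eval (@fg_gen d) w.

Definition word_inv w := rev (map (@letter_inv d) w).

Lemma size_word_inv w : size (word_inv w) = size w.
Proof. by rewrite size_rev size_map. Qed.

Lemma word_inv_cat u v : word_inv (u ++ v) = word_inv v ++ word_inv u.
Proof. by rewrite /word_inv map_cat rev_cat. Qed.

Lemma fg_word_eval_act w : fg_word (ev w) = foldr (@push d) [::] w.
Proof.
rewrite /ev; elim: w => [|l w IHw]; first by rewrite word_eval_nil.
by rewrite word_eval_cons /= -IHw; case: l => i [].
Qed.

Lemma fg_word_ev w : reduced w -> fg_word (ev w) = w.
Proof. by move=> rw; rewrite fg_word_eval_act act_reduced. Qed.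

Lemma ev_fg_word x : ev (fg_word x) = x.
Proof. exact: fg_word_eval. Qed.

Lemma ev_cat u v : ev (u ++ v) = ev u * ev v.
Proof. exact: word_eval_cat. Qed.

Lemma ev_inv w : ev (word_inv w) = (ev w)^-1.
Proof. exact: word_eval_inv. Qed.

Lemma fg_wordV x : fg_word x^-1 = word_inv x.
Proof. by []. Qed.

Lemma reduced_catP u v : reduced (u ++ v) -> reduced u /\ reduced v.
Proof.
rewrite /reduced; case: u => [|l u] //=; rewrite cat_path => /andP[-> pv].
by split => //; exact: path_sorted pv.
Qed.

Lemma reduced_cat_glue u v w : v != [::] -> reduced (u ++ v) -> reduced (v ++ w) ->
  reduced (u ++ v ++ w).
Proof.
case: v => // l v _; rewrite /reduced; case: u => [|l' u] //=.
by rewrite !cat_path /= !cat_path => /and3P[-> -> _].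
Qed.

(** The product of two reduced words cancels a suffix [c] of the first against the
    prefix [c^-1] of the second, and is then reduced. *)
Lemma fg_wordM_cancel x y : exists a b c,
  [/\ fg_word x = a ++ c, fg_word y = word_inv c ++ b & fg_word (x * y) = a ++ b].
Proof.
change (fg_word (x * y)) with (foldr (@push d) (fg_word y) (fg_word x)).
elim: (fg_word x) (fg_reduced x) => [|l u IHu] red_u.
  by exists [::], (fg_word y), [::].
have [a [b [c [uE yE vE]]]] := IHu (path_sorted red_u).
rewrite /= vE; case: a uE vE => [|l' a] /= uE vE; last first.
  exists (l :: l' :: a), b, c; rewrite /= uE; split => //.
  by move: red_u; rewrite uE /reduced /= => /andP[/negPf ->].
case: b yE vE => [|l' b] yE vE /=.
  by exists [:: l], [::], c; rewrite uE.
case: eqVneq yE => [-> yE|_ yE]; last by exists [:: l], (l' :: b), c; rewrite uE.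
exists [::], b, (l :: c); rewrite uE; split => //.
by rewrite yE -[l :: c]cat1s word_inv_cat -catA.
Qed.

(** The cancellation in [x * x] is shorter than half of [x], because a reduced
    word does not have a prefix and a suffix of half its size which are inverse
    to each other. *)
Lemma cyclic_reduction x : x != 1 -> exists c m,
  [/\ m != [::], fg_word x = word_inv c ++ m ++ c & reduced (m ++ m)].
Proof.
move=> x1; have [a [b [c [xa xb xxE]]]] := fg_wordM_cancel x x.
have sxa := congr1 size xa; have sxb := congr1 size xb.
rewrite !size_cat ?size_word_inv in sxa sxb.
have red_xx : reduced (a ++ b) by rewrite -xxE; exact: fg_reduced.
have [cx|xc] := ltnP (size c).*2 (size (fg_word x)).
  have aE : a = word_inv c ++ drop (size c) a.
    have := congr1 (take (size c)) (etrans (esym xa) xb).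
    rewrite takel_cat; last by lia.
    rewrite take_size_cat ?size_word_inv// => <-.
    by rewrite cat_take_drop.
  exists c, (drop (size c) a); split.
  - by rewrite -size_eq0 -lt0n size_drop subn_gt0 -(ltn_add2r (size c)) addnn -sxa.
  - by rewrite catA -aE.
  - have bE : b = drop (size c) a ++ c.
      apply/eqP; have := eqseq_cat b (drop (size c) a ++ c) (erefl (size (word_inv c))).
    by rewrite eqxx /= => <-; rewrite catA -aE -xa -xb.
    move: red_xx; rewrite aE bE -catA => /reduced_catP[_].
    by rewrite -aE catA => /reduced_catP[].
have x0 : (0 < size (fg_word x))%N.
  by rewrite lt0n size_eq0; apply: contra x1 => /eqP xE; apply/eqP/val_inj.
(* Otherwise the letters at positions [i] and [n - 1 - i] are inverse to each
   other for all [i] below the middle: for odd [n] the middle letter is its own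
   inverse, and for even [n] the two middle letters cancel. *)
exfalso; pose n := size (fg_word x).
have [l0 _] : exists l : letter d, True by case: (fg_word x) x0 => // l; exists l.
have nthV i : (i < size c)%N ->
    nth l0 x i = letter_inv (nth l0 x (n - i.+1)).
  move=> ic; rewrite {1}xb nth_cat size_word_inv ic nth_rev size_map//.
  rewrite (nth_map l0) ?xa ?nth_cat; last by lia.
  have -> : (n - i.+1 < size a)%N = false by rewrite /n; lia.
  by congr (letter_inv (nth _ _ _)); rewrite /n; lia.
have neqV (l : letter d) : l != letter_inv l.
  by apply/eqP => /(congr1 snd) /=; case: l.2.
have nE : n = odd n + n./2.*2 by rewrite odd_double_half.
case: (odd n) nE => /= nE.
  have := nthV n./2; rewrite {3}nE.
  have -> : (true + n./2.*2 - n./2.+1)%N = n./2 by lia.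
  have -> : (n./2 < size c)%N by rewrite /n in nE *; lia.
  by move=> /(_ isT) /eqP; rewrite (negPf (neqV _)).
have n2 : (0 < n./2)%N by rewrite /n in nE *; lia.
have /(sortedP l0)/(_ n./2.-1) := fg_reduced x.
have hc : (n./2 <= size c)%N by rewrite /n in nE *; lia.
rewrite prednK// -/n (nthV n./2.-1) ?prednK//.
rewrite letter_invK; have -> : (n - n./2)%N = n./2 by lia.
by rewrite eqxx => /(_ ltac:(lia)).
Qed.

Definition word_rep m N : seq (letter d) := locked (flatten (nseq N m)).

Lemma word_repS m N : word_rep m N.+1 = m ++ word_rep m N.
Proof. by rewrite /word_rep -!lock. Qed.

Lemma size_word_rep m N : m != [::] -> (N <= size (word_rep m N))%N.
Proof.
rewrite -size_eq0 -lt0n => m0; elim: N => // N IHN; rewrite word_repS size_cat.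
by rewrite -add1n leq_add.
Qed.

Lemma word_repD m N N' : word_rep m (N + N') = word_rep m N ++ word_rep m N'.
Proof. by rewrite /word_rep -!lock nseqD flatten_cat. Qed.

Lemma word_rep1 m : word_rep m 1 = m.
Proof. by rewrite /word_rep -lock; exact: cats0. Qed.

Lemma cyclic_power c m N : m != [::] -> reduced (word_inv c ++ m ++ c) ->
  reduced (m ++ m) ->
  fg_word (ev (word_inv c ++ m ++ c) ^+ N.+1) =
  word_inv c ++ word_rep m N.+1 ++ c.
Proof.
move=> m0 red_cmc red_mm.
have red_N : reduced (word_inv c ++ word_rep m N.+1 ++ c).
  elim: N => [|N IHN]; first by rewrite word_rep1.
  rewrite !word_repS -!catA in IHN *.
  apply: reduced_cat_glue => //.
    by rewrite catA in red_cmc; case/reduced_catP: red_cmc.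
  apply: reduced_cat_glue => //.
  by case/reduced_catP: IHN.
rewrite -[RHS]fg_word_ev//; congr fg_word.
rewrite !ev_cat !ev_inv; set k := ev c.
have -> : ev (word_rep m N.+1) = ev m ^+ N.+1.
  elim: N {red_N} => [|N IHN]; first by rewrite word_rep1.
  by rewrite expgS -IHN word_repS ev_cat.
by have := conjXg (ev m) k N.+1; rewrite !conjgE => ->.
Qed.

(** A nontrivial element [x] has an infinite ray [x ^+ oo], whose prefix of
    length [n] is read off from any power [x ^+ N] with [n <= N]. *)
Definition ray x n : seq (letter d) := take n (fg_word (x ^+ n)).

Lemma size_power_ge x N : x != 1 -> (N <= size (fg_word (x ^+ N)))%N.
Proof.
move=> /cyclic_reduction[c [m [m0 xE red_mm]]]; case: N => // N.
rewrite -[x]ev_fg_word xE cyclic_power// -?xE ?fg_reduced// !size_cat.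
by rewrite (leq_trans (size_word_rep N.+1 m0))// addnCA leq_addr.
Qed.

Lemma ray_stable x n N : x != 1 -> (n <= N)%N -> take n (fg_word (x ^+ N)) = ray x n.
Proof.
move=> /cyclic_reduction[c [m [m0 xE red_mm]]]; rewrite /ray.
case: n => [|n]; first by rewrite !take0.
case: N => // N nN; rewrite -[x]ev_fg_word xE !cyclic_power// -?xE ?fg_reduced//.
have sn k : (n < k)%N -> (n.+1 <= size (word_inv c ++ word_rep m k))%N.
  by move=> nk; rewrite size_cat (leq_trans _ (leq_addl _ _))// (leq_trans nk)// size_word_rep.
rewrite !catA ![take _ (_ ++ c)]takel_cat ?sn//.
have -> : word_rep m N.+1 = word_rep m n.+1 ++ word_rep m (N - n).
  by rewrite -word_repD addSn subnKC.
by rewrite catA takel_cat// sn.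
Qed.

Lemma size_ray x n : x != 1 -> size (ray x n) = n.
Proof. by move=> x1; rewrite size_takel// size_power_ge. Qed.

Lemma take_ray x n N : x != 1 -> (n <= N)%N -> take n (ray x N) = ray x n.
Proof. by move=> x1 nN; rewrite /ray take_takel// ray_stable. Qed.

Lemma expg_eq1 x n : x != 1 -> (x ^+ n == 1) = (n == 0%N).
Proof.
move=> x1; apply/eqP/eqP => [xn|->//].
by apply/eqP; rewrite -leqn0 -[0%N]/(size (fg_word (1 : F))) -xn size_power_ge.
Qed.

Lemma invg_neq1 x : x != 1 -> x^-1 != 1.
Proof. by rewrite invg_eq1. Qed.

(** North-south dynamics: if [g] does not begin like the negative powers of [x],
    then fewer than [n] letters of [x ^+ N] are cancelled in [x ^+ N * g]. *)
Lemma power_attracts x g n N : x != 1 -> (n.*2 <= N)%N ->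
  take n (fg_word g) <> ray x^-1 n -> take n (fg_word (x ^+ N * g)) = ray x n.
Proof.
move=> x1 nN gx; have [a [b [c [xa gb xgE]]]] := fg_wordM_cancel (x ^+ N) g.
have [cn|nc] := ltnP (size c) n; last first.
  case: gx; rewrite gb -(@ray_stable x^-1 n N) ?invg_neq1//; last by lia.
  rewrite expVgn fg_wordV xa word_inv_cat !takel_cat// size_word_inv//.
have := size_power_ge N x1; rewrite xa size_cat => sN.
rewrite xgE takel_cat; last by lia.
rewrite -(@ray_stable x n N)//; last by lia.
by rewrite xa takel_cat//; lia.
Qed.

(** Translation by [t] along the ray of [x], far enough from the origin. *)
Definition shifts x y (t : int) : Prop :=
  exists n0, forall n, (n0 <= n)%N -> exists2 M : nat,
    (M%:Z = n%:Z + t)%R & y * ev (ray x n) = ev (ray x M).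

Lemma reduced_ray x n : reduced (ray x n).
Proof.
have := fg_reduced (x ^+ n); rewrite -{1}(cat_take_drop n (x ^+ n)).
by case/reduced_catP.
Qed.

(** Both [y * x ^+ N] and [x ^+ N * y] agree with a long piece of the ray, the
    second because at most [size y] letters at the far end are affected. The
    letters [c] of [y] cancelled against the ray do not depend on [N], so that
    [y] moves the ray by [size a - size c], where [y = a ++ c]. *)
Lemma commute_shifts x y : x != 1 -> commute y x -> exists t, shifts x y t.
Proof.
move=> x1 yx; set s := size (fg_word y).
have [a [b [c [yE rE yrE]]]] := fg_wordM_cancel y (ev (ray x s)).
have red_ab : reduced (a ++ b) by rewrite -yrE; exact: fg_reduced.
rewrite fg_word_ev ?reduced_ray// in rE.
have sE : s = (size c + size b)%N.
  by rewrite -(size_ray s x1) rE size_cat size_word_inv.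
have sE' : s = (size a + size c)%N by rewrite /s yE size_cat.
have act r : reduced (word_inv c ++ b ++ r) ->
    fg_word (y * ev (word_inv c ++ b ++ r)) = a ++ b ++ r.
  move=> red_cbr; rewrite -{1}[y]ev_fg_word yE !ev_cat ev_inv.
  rewrite -mulgA mulVKg -!ev_cat fg_word_ev//.
  have [b0|b0] := eqVneq b [::]; last first.
    by apply: reduced_cat_glue => //; case/reduced_catP: red_cbr.
  have -> : a = [::] by apply: size0nil; move: sE; rewrite sE' b0 /=; lia.
  by case/reduced_catP: red_cbr.
exists ((size a)%:Z - (size c)%:Z)%R, s => n sn.
pose M := (size a + n - size c)%N; exists M; first by rewrite /M; lia.
pose N := (M + s + n)%N; pose r := drop s (fg_word (x ^+ N)).
have xNE : fg_word (x ^+ N) = word_inv c ++ b ++ r.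
  rewrite catA -rE -(@ray_stable x s N)//; last by rewrite /N; lia.
  by rewrite cat_take_drop.
have xnE : ray x n = word_inv c ++ b ++ take (n - s) r.
  rewrite -(@ray_stable x n N)//; last by rewrite /N; lia.
  rewrite xNE catA take_cat size_cat size_word_inv -sE ltnNge sn /=.
  by rewrite -catA.
have yxN : fg_word (y * x ^+ N) = a ++ b ++ r.
  rewrite -[X in y * X]ev_fg_word xNE; apply: act; rewrite -xNE; exact: fg_reduced.
apply: val_inj => /=; rewrite -[LHS]/(fg_word (y * ev (ray x n))) xnE act; last first.
  by rewrite -xnE; exact: reduced_ray.
rewrite [RHS]fg_word_ev ?reduced_ray// -(@ray_stable x M N)//; last by rewrite /N; lia.
have -> : take M (fg_word (x ^+ N)) = take M (fg_word (x ^+ N * y)).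
  have [a' [b' [c' [xNE' yE' ->]]]] := fg_wordM_cancel (x ^+ N) y.
  have := size_power_ge N x1; rewrite xNE' size_cat => sN.
  have sc' : (size c' <= s)%N by rewrite /s yE' size_cat size_word_inv leq_addr.
  by rewrite !takel_cat//; rewrite /N in sN; lia.
rewrite -(commuteX N yx) yxN [X in take M X]catA take_cat size_cat.
have -> : (M < size a + size b)%N = false by rewrite /M; lia.
by rewrite -catA; do 2 congr cat; congr take; rewrite /M; lia.
Qed.

Lemma shifts_inj x y z t : shifts x y t -> shifts x z t -> y = z.
Proof.
move=> [n yn] [n' zn']; have [M ME yE] := yn _ (leq_maxl n n').
have [M' M'E zE] := zn' _ (leq_maxr n n').
have MM' : M = M' by lia.
by apply: (@mulIg _ (ev (ray x (maxn n n')))); rewrite yE zE MM'.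
Qed.

Lemma shiftsM x y z t t' : shifts x y t -> shifts x z t' -> shifts x (y * z) (t + t').
Proof.
move=> [n yn] [n' zn]; exists (n' + n + `|t'|)%N => k nk.
have [M ME zE] := zn k ltac:(lia); have [M' M'E yE] := yn M ltac:(lia).
by exists M'; [lia|rewrite -mulgA zE yE].
Qed.

Lemma shiftsV x y t : shifts x y t -> shifts x y^-1 (- t).
Proof.
move=> [n yn]; exists (n + `|t|)%N => k nk.
have [M ME yE] := yn `|(k%:Z - t)%R|%N ltac:(lia).
have -> : k = M by lia.
by exists `|(k%:Z - t)%R|%N; [lia|rewrite -yE mulKg].
Qed.

Lemma shifts1 x : shifts x 1 0.
Proof. by exists 0%N => n _; exists n; rewrite ?addr0 ?mul1g. Qed.

Lemma shiftsX x y t k : shifts x y t -> shifts x (y ^+ k) (t *+ k).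
Proof.
move=> xyt; elim: k => [|k IHk]; first exact: shifts1.
by rewrite expgS mulrS; exact: shiftsM.
Qed.

Lemma shifts_commute x y z t t' : shifts x y t -> shifts x z t' -> commute y z.
Proof.
move=> yt zt; apply: (@shifts_inj x _ _ (t + t')%R); first exact: shiftsM.
by rewrite addrC; exact: shiftsM.
Qed.

(** Elements commuting with [x] translate its ray, and translations commute. *)
Lemma commute_trans x y z : x != 1 -> commute y x -> commute z x -> commute y z.
Proof.
move=> x1 /(commute_shifts x1)[t yt] /(commute_shifts x1)[t' zt'].
exact: shifts_commute yt zt'.
Qed.

Lemma expg_inj x : x != 1 -> injective (fun n => x ^+ n).
Proof.
move=> x1 m n; wlog mn : m n / (m <= n)%N => [hw|].
  by case: (leqP m n) => [/hw//|/ltnW /hw h /esym/h].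
move=> /esym/eqP; rewrite -(subnKC mn) expgnDr -[X in _ == X]mulg1 => /eqP/mulgI/eqP.
by rewrite expg_eq1// => /eqP ->; rewrite addn0.
Qed.

(** If the rays coincide, both elements translate the same ray. *)
Lemma ray_eq_commute x y : x != 1 -> y != 1 -> ray x =1 ray y -> commute x y.
Proof.
move=> x1 y1 xy; have [t xt] := commute_shifts x1 (commute_refl x).
have [t' [n0 yt']] := commute_shifts y1 (commute_refl y).
have yt : shifts x y t'.
  by exists n0 => n /yt'[M ME yE]; exists M; rewrite // !xy.
exact: shifts_commute xt yt.
Qed.

(** A subgroup of the centralizer of [x] is generated by an element of least
    positive translation length along the ray of [x]. *)
Lemma centralizer_cyclic x (H : set F) : x != 1 -> is_subgroup H -> H x ->
  (forall y, H y -> commute y x) ->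
  exists2 z, H z & forall y, H y -> exists k, y = z ^+ k \/ y = z ^- k.
Proof.
move=> x1 sgH Hx Hcom.
have Hsh y : H y -> exists t, shifts x y t by move=> /Hcom/(commute_shifts x1).
have : exists n, `[< (0 < n)%N /\ exists2 y, H y & shifts x y (Posz n) >].
  have [t xt] := Hsh x Hx; exists `|t|%N; apply/asboolP; split.
    rewrite absz_gt0; apply: contra x1 => /eqP t0; apply/eqP.
    by apply: shifts_inj xt _; rewrite t0; exact: shifts1.
  have [t0|t0] := leP 0%R t; first by exists x => //; have -> : Posz `|t| = t by lia.
  exists x^-1; first exact: subgroupV.
  have -> : Posz `|t| = (- t)%R by lia.
  exact: shiftsV.
move=> /ex_minnP[n /asboolP[n0 [z Hz zn]] n_min]; exists z => // y Hy.
have [t yt] := Hsh y Hy.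
pose q := (t %/ n%:Z)%Z; pose r := (t %% n%:Z)%Z.
have [w [Hw wq [k wk]]] : exists w : F, [/\ H w, shifts x w (q * n%:Z)%R &
    exists k, w = z ^+ k \/ w = z ^- k].
  have [q0|q0] := leP 0%R q.
    exists (z ^+ `|q|); split; [exact: subgroupX| |by exists `|q|%N; left].
    have -> : (q * n%:Z = n%:Z *+ `|q|)%R by rewrite -mulr_natl; lia.
    exact: shiftsX.
  exists (z ^- `|q|); split; [|  |by exists `|q|%N; right].
    by apply: subgroupV => //; exact: subgroupX.
  have -> : (q * n%:Z = - (n%:Z *+ `|q|))%R by rewrite -mulr_natl; lia.
  exact/shiftsV/shiftsX.
suff -> : y = w by exists k.
have rE : r = (- (q * n%:Z) + t)%R by rewrite /r /q; lia.
have wyr : shifts x (w^-1 * y) r by rewrite rE; apply: shiftsM => //; exact: shiftsV.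
have Hwy : H (w^-1 * y) by apply: subgroupM => //; exact: subgroupV.
have r0 : (0 <= r)%R by rewrite modz_ge0//; lia.
have rn : (r < n%:Z)%R by rewrite ltz_pmod//; lia.
have [r00|rpos] := eqVneq r 0%R.
  have : w^-1 * y = 1 by apply: shifts_inj (shifts1 x); rewrite -r00.
  by move=> wy; rewrite -[y](mulVKg w) wy mulg1.
have := n_min `|r|%N; suff -> : `[< (0 < `|r|)%N /\ exists2 y, H y & shifts x y (Posz `|r|) >].
  by move=> /(_ isT); lia.
apply/asboolP; split; first by lia.
by exists (w^-1 * y) => //; have -> : Posz `|r| = r by lia.
Qed.

End FreeGroupRays.

Section AmenableFree.
Variables (R : realType) (d : nat).
Local Open Scope group_scope.
Let F := free_group d.
Implicit Types (H : set F) (x y z g : F).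

(** Powers of [x] push everything away from the two ends of its axis, so an
    invariant mean lives near these ends. *)
Lemma mean_off_axis H m x n : is_subgroup H -> @is_mean R F H m -> H x -> x != 1 ->
  m (H `&` [set g | take n (fg_word g) <> ray x n /\
                    take n (fg_word g) <> ray x^-1 n]) = 0%R.
Proof.
move=> sgH mm Hx x1; apply: (mean_wandering (h := x ^+ n.*2) sgH mm).
- exact: subgroupX.
- by move=> g [].
- move=> i g [Hg [_ gx]] [_ [+ _]]; apply.
  by rewrite -expgnA power_attracts// leq_pmulr.
Qed.

(** The mean lives near the ends of [x] and near those of [y], at every scale,
    so [x] and [y] have an end in common. *)
Lemma amenable_commute H x y : is_subgroup H -> amenable R H ->
  H x -> H y -> commute x y.
Proof.
move=> sgH [m mm] Hx Hy.
have [->|x1] := eqVneq x 1; first exact/commute_sym/commute1.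
have [->|y1] := eqVneq y 1; first exact: commute1.
have near n : exists (s t : bool),
    ray (if s then x else x^-1) n = ray (if t then y else y^-1) n.
  apply: contrapT => nst.
  have [m0 m1 _ _] := mm.
  have: (m H <= 0)%R; last by rewrite m1 ler10.
  rewrite -[leRHS]addr0 -{1}(mean_off_axis n sgH mm Hx x1) -(mean_off_axis n sgH mm Hy y1).
  apply: le_trans (mean_setU_le mm _ _); [|by move=> g []|by move=> g []].
  apply: mean_le mm _ _ => [g Hg|g [[]|[]]//].
  have [gx|gx] := pselect (take n (fg_word g) = ray x n \/ take n (fg_word g) = ray x^-1 n).
    right; split => //; split => gy; apply: nst.
      by case: gx => gx; [exists true, true|exists false, true]; rewrite -gx -gy.
    by case: gx => gx; [exists true, false|exists false, false]; rewrite -gx -gy.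
  by left; split => //; split => gy; apply: gx; [left|right].
have sx1 (s : bool) : (if s then x else x^-1) != 1 by case: s; rewrite ?invg_eq1.
have sy1 (s : bool) : (if s then y else y^-1) != 1 by case: s; rewrite ?invg_eq1.
have [s [t st]] : exists s t : bool,
    ray (if s then x else x^-1) =1 ray (if t then y else y^-1).
  apply: contrapT => nst.
  have far s t : exists n, ray (if s then x else x^-1) n <> ray (if t then y else y^-1) n.
    apply: contrapT => nn; apply: nst; exists s, t => n.
    by apply: contrapT => nE; apply: nn; exists n.
  have [n1 e1] := far true true; have [n2 e2] := far true false.
  have [n3 e3] := far false true; have [n4 e4] := far false false.
  have [s [t]] := near (n1 + n2 + n3 + n4)%N.
  move=> /(congr1 (fun w => (take n1 w, take n2 w, take n3 w, take n4 w))).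
  rewrite !take_ray ?sx1 ?sy1//; try lia.
  by case: s; case: t => -[].
have := ray_eq_commute (sx1 s) (sy1 t) st.
case: s t {st} => -[] //.
- by move=> /commuteV; rewrite invgK.
- by move=> /commute_sym/commuteV/commute_sym; rewrite invgK.
- by move=> /commuteV/commute_sym/commuteV/commute_sym; rewrite !invgK.
Qed.

Lemma amenable_cyclic H : is_subgroup H -> amenable R H ->
  exists2 z, H z & forall y, H y -> exists k, y = z ^+ k \/ y = z ^- k.
Proof.
move=> sgH aH; have [[x [Hx x1]]|H1] := pselect (exists x, H x /\ x != 1).
  by apply: (centralizer_cyclic x1) => // y Hy; exact: amenable_commute aH _ _.
exists 1; first exact: subgroup1.
move=> y Hy; exists 0%N; left; rewrite expg0; apply: contrapT => /eqP y1.
by apply: H1; exists y.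
Qed.

(** Conjugation by an element normalizing an infinite cyclic group maps a
    generator to itself or to its inverse. *)
Lemma normalizer_sqr_commute H z g : is_subgroup H -> z != 1 -> H z ->
  (forall y, H y -> exists k, y = z ^+ k \/ y = z ^- k) ->
  H (z ^ g) -> H (z ^ g^-1) -> commute (g ^+ 2) z.
Proof.
move=> sgH z1 Hz Hcyc zg zgV.
have [i iE] := Hcyc _ zg; have [j jE] := Hcyc _ zgV.
have ij : (i * j = 1)%N.
  have zE : z = (z ^ g^-1) ^ g by rewrite conjgKV.
  have : z = z ^+ (i * j) \/ z = z ^- (i * j).
    move: zE; case: jE => ->; rewrite ?conjVg conjXg; case: iE => ->;
      rewrite ?expVgn ?invgK -expgnA; by [left|right].
  case=> [|/esym/eqP]; first by rewrite -{1}[z]expg1 => /(expg_inj z1).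
  by rewrite eq_sym -mulg_eq1 -expgS expg_eq1.
have i1 : i = 1%N by move/eqP: ij; rewrite muln_eq1 => /andP[/eqP].
have : z ^ (g ^+ 2) = z.
  rewrite expg2 conjgM; move: iE; rewrite i1 expg1 => -[zE|zE]; first by rewrite !zE.
  by rewrite zE conjVg zE invgK.
move=> /conjg_fixP /commgP; exact: commute_sym.
Qed.

(** A nontrivial amenable subgroup is infinite cyclic; the squares of the elements
    normalizing it lie in its centralizer, which is commutative. *)
Lemma amenable_normalizer H g h : is_subgroup H -> amenable R H ->
  (forall x, H x -> [/\ H (x ^ g), H (x ^ g^-1), H (x ^ h) & H (x ^ h^-1)]) ->
  ~ commute (g ^+ 2) (h ^+ 2) -> H = [set 1].
Proof.
move=> sgH aH Hn ngh; have [z Hz Hcyc] := amenable_cyclic sgH aH.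
have [z1|z1] := eqVneq z 1.
  apply/seteqP; split => y; last by move=> ->; exact: subgroup1.
  by move=> /Hcyc[k [->|->]]; rewrite z1 expg1n ?invg1.
have [zg zgV zh zhV] := Hn z Hz.
have gz := normalizer_sqr_commute sgH z1 Hz Hcyc zg zgV.
have hz := normalizer_sqr_commute sgH z1 Hz Hcyc zh zhV.
by case: ngh; exact: commute_trans z1 gz hz.
Qed.

End AmenableFree.
(** * Wreath products over a finite set *)

(** A pair [(p, f)] acts on [X * G] by [(x, s) |-> (p x, f x * s)]. *)
Definition wreath (X : finType) (G : groupType) : Type :=
  ({perm X} * {ffun X -> G})%type.

Section Wreath.
Variables (X : finType) (G : groupType).
Implicit Types (x y : X) (s t : G).
Local Open Scope group_scope.

HB.instance Definition _ := Choice.on (wreath X G).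

Let W := wreath X G.
Implicit Types (g h n : W).

Definition wact g x : X := g.1 x.
Definition wlamp g x : G := g.2 x.

Definition wmk (p : {perm X}) (f : X -> G) : W := (p, [ffun x => f x]).

Definition wreath_one : W := wmk 1 (fun=> 1).
Definition wreath_mul g h : W := wmk (h.1 * g.1) (fun x => wlamp g (wact h x) * wlamp h x).
Definition wreath_inv g : W := wmk g.1^-1 (fun x => (wlamp g (g.1^-1 x))^-1).

Lemma wact_mk p f x : wact (wmk p f) x = p x. Proof. by []. Qed.
Lemma wlamp_mk p f x : wlamp (wmk p f) x = f x. Proof. exact: ffunE. Qed.

Lemma wreath_ext g h : wact g =1 wact h -> wlamp g =1 wlamp h -> g = h.
Proof.
case: g h => [p f] [p' f'] pp' ff'; congr pair; first exact/permP.
exact/ffunP.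
Qed.

Fact wreath_mulA : associative wreath_mul.
Proof.
move=> g h n; apply: wreath_ext => x; rewrite ?wact_mk ?wlamp_mk.
  by rewrite !permM.
by rewrite mulgA /wact permM.
Qed.

Fact wreath_mul1 : left_id wreath_one wreath_mul.
Proof.
move=> g; apply: wreath_ext => x; rewrite ?wact_mk ?wlamp_mk ?mul1g//.
by rewrite permM perm1.
Qed.

Fact wreath_mulr1 : right_id wreath_one wreath_mul.
Proof.
move=> g; apply: wreath_ext => x; rewrite ?wact_mk ?wlamp_mk ?mulg1.
  by rewrite permM perm1.
by rewrite /wact /= perm1.
Qed.

Fact wreath_mulV : left_inverse wreath_one wreath_inv wreath_mul.
Proof.
move=> g; apply: wreath_ext => x; rewrite ?wact_mk ?wlamp_mk.
  by rewrite permM permK perm1.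
by rewrite /wact permK mulVg.
Qed.

Fact wreath_mulrV : right_inverse wreath_one wreath_inv wreath_mul.
Proof.
move=> g; apply: wreath_ext => x; rewrite ?wact_mk ?wlamp_mk.
  by rewrite permM permKV perm1.
by rewrite mulgV.
Qed.

HB.instance Definition _ := isGroup.Build (wreath X G)
  wreath_mulA wreath_mul1 wreath_mulr1 wreath_mulV wreath_mulrV.

Lemma wactM g h x : wact (g * h) x = wact g (wact h x).
Proof. exact: permM. Qed.

Lemma wlampM g h x : wlamp (g * h) x = wlamp g (wact h x) * wlamp h x.
Proof. exact: wlamp_mk. Qed.

Lemma wact1 x : wact 1 x = x. Proof. exact: perm1. Qed.
Lemma wlamp1 x : wlamp 1 x = 1. Proof. exact: wlamp_mk. Qed.

Lemma wactK g x : wact g^-1 (wact g x) = x.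
Proof. by rewrite -wactM mulVg wact1. Qed.

Lemma wactKV g x : wact g (wact g^-1 x) = x.
Proof. by rewrite -wactM mulgV wact1. Qed.

Lemma wact_inj g : injective (wact g).
Proof. exact: perm_inj. Qed.

Lemma wlampV g x : wlamp g^-1 x = (wlamp g (wact g^-1 x))^-1.
Proof. exact: wlamp_mk. Qed.

Definition wat x s : W := wmk 1 (fun y => if y == x then s else 1).

Lemma wact_at x s y : wact (wat x s) y = y.
Proof. exact: perm1. Qed.

Lemma wlamp_at x s y : wlamp (wat x s) y = if y == x then s else 1.
Proof. exact: wlamp_mk. Qed.

Lemma watM x s t : wat x (s * t) = wat x s * wat x t.
Proof.
apply: wreath_ext => y; rewrite ?wactM ?wlampM !(wact_at, wlamp_at)//.
by case: eqP; rewrite ?mulg1.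
Qed.

Lemma watV x s : wat x s^-1 = (wat x s)^-1.
Proof.
apply/esym/mulg1_eq; rewrite -watM mulgV; apply: wreath_ext => y.
  by rewrite wact_at wact1.
by rewrite wlamp_at wlamp1 if_same.
Qed.

Lemma conj_wat g x s : g * wat x s * g^-1 = wat (wact g x) (s ^ (wlamp g x)^-1).
Proof.
apply: (@mulIg _ g); rewrite mulgVK; apply: wreath_ext => y.
  by rewrite !wactM !wact_at.
rewrite !wlampM !wact_at !wlamp_at (inj_eq (@wact_inj g)).
by case: eqP => [->|]; rewrite ?mul1g ?mulg1// conjgE invgK mulgA mulgVK.
Qed.

End Wreath.

Section NormalAmenable.
Variable R : realType.
Local Open Scope group_scope.

Definition normalized_by (G : groupType) (S N : set G) : Prop :=
  forall s n, S s -> N n -> N (n ^ s) /\ N (n ^ s^-1).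

(** Every subgroup of [G] containing a rigid set has trivial amenable radical. As
    [N] is not required to lie in a given group containing [S], the property
    passes from the coordinates to a wreath product. *)
Definition amenably_rigid (G : groupType) (S : set G) : Prop :=
  forall N, is_subgroup N -> amenable R N -> normalized_by S N -> N `<=` [set 1].

Lemma wlamp_stab_morph (X : finType) (G : groupType) (N : set (wreath X G)) (x : X) :
  morph_on (N `&` [set n | wact n x = x]) (fun n => wlamp n x).
Proof. by move=> g h _ [_ hx] /=; rewrite wlampM hx. Qed.

Lemma subgroup_stab (X : finType) (G : groupType) (N : set (wreath X G)) (x : X) :
  is_subgroup N -> is_subgroup (N `&` [set n | wact n x = x]).
Proof.
move=> sgN; apply: subgroup_setI => //; apply/is_subgroupP; split => /=.
- exact: wact1.
- by move=> g h gx hx; rewrite wactM hx gx.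
- by move=> g gx; rewrite -{1}gx wactK.
Qed.

Lemma amenable_wlamp (X : finType) (G : groupType) (N : set (wreath X G)) (x : X) :
  is_subgroup N -> amenable R N ->
  let N' := (fun n => wlamp n x) @` (N `&` [set n | wact n x = x]) in
  is_subgroup N' /\ amenable R N'.
Proof.
move=> sgN aN; have sgS := subgroup_stab x sgN; split.
  exact: (subgroup_image sgS (wlamp_stab_morph (x := x))).
apply: (amenable_image sgS (wlamp_stab_morph (x := x))).
by apply: (amenable_sub sgN sgS _ aN) => n [].
Qed.

(** The lamps at [x] of the stabilizer of [x] in [N] form an amenable subgroup
    normalized by [S], hence are trivial. If [n] in [N] moves [x], then the
    commutator of [n] and [wat x s] lies in [N], fixes [x], and has lamp [s^-1]
    there, so that [s = 1]. *)
Lemma wreath_rigid (X : finType) (G : groupType) (S : set G)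
    (T : set (wreath X G)) : amenably_rigid S -> (exists2 s, S s & s <> 1) ->
  (forall x s, S s -> T (wat x s)) -> amenably_rigid T.
Proof.
move=> rS [s0 Ss0 s01] ST N sgN aN nN.
have lamp1 x n : N n -> wact n x = x -> wlamp n x = 1.
  move=> Nn nx; have [sgN' aN'] := amenable_wlamp x sgN aN.
  apply: (rS _ sgN' aN'); last by exists n.
  have conj s k : N k -> wact k x = x -> N (k ^ wat x s) ->
    ((fun n => wlamp n x) @` (N `&` [set n | wact n x = x])) (wlamp k x ^ s).
    move=> Nk kx Nks; exists (k ^ wat x s); first split => //=.
      by rewrite conjgE -watV !wactM !wact_at.
    by rewrite !conjgE -watV !wlampM !wactM !wact_at kx !wlamp_at eqxx.
  move=> s _ Ss [k [Nk kx] <-]; have [Nks NksV] := nN _ _ (ST x s Ss) Nk.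
  by split; [exact: conj|apply: conj; rewrite // watV].
have fixed x n : N n -> wact n x = x.
  move=> Nn; apply: contrapT => /eqP nx; apply: s01.
  pose k := n * wat x s0 * n^-1 * (wat x s0)^-1.
  have Nk : N k.
    rewrite /k -!mulgA; apply: subgroupM => //.
    have [_] := nN _ _ (ST x s0 Ss0) (subgroupV sgN Nn).
    by rewrite conjgE invgK.
  have := lamp1 x k Nk; rewrite /k conj_wat -watV wactM !wact_at => /(_ erefl).
  rewrite wlampM wact_at !wlamp_at eqxx eq_sym (negPf nx) mul1g.
  by move=> /eqP; rewrite invg_eq1 => /eqP.
move=> n Nn; apply: wreath_ext => x; first by rewrite wact1 fixed.
by rewrite wlamp1 lamp1// fixed.
Qed.

End NormalAmenable.

Section FinitelyGenerated.
Local Open Scope group_scope.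

Definition generated (G : groupType) (l : seq G) : set G :=
  smallest (@is_subgroup G) [set` l].

Lemma generated_subgroup (G : groupType) (l : seq G) : is_subgroup (generated l).
Proof.
apply/is_subgroupP; split.
- by move=> H [sgH _]; exact: subgroup1.
- by move=> x y Hx Hy H HH; case: (HH) => sgH _; exact: subgroupM (Hx _ HH) (Hy _ HH).
- by move=> x Hx H HH; case: (HH) => sgH _; exact: subgroupV (Hx _ HH).
Qed.

Lemma mem_generated (G : groupType) (l : seq G) x : x \in l -> generated l x.
Proof. by move=> xl H [_]; exact. Qed.

Lemma generated_min (G : groupType) (l : seq G) H :
  is_subgroup H -> (forall x, x \in l -> H x) -> generated l `<=` H.
Proof. by move=> sgH lH x; exact. Qed.

Definition finitely_generated (G : groupType) (H : set G) : Prop :=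
  exists l, H = generated l.

(** Generators of the kernel, together with lifts of generators of the image. *)
Lemma fg_extension (G G' : groupType) (H : set G) (phi : G -> G') :
  is_subgroup H -> morph_on H phi -> finitely_generated (phi @` H) ->
  finitely_generated (H `&` [set x | phi x = 1]) -> finitely_generated H.
Proof.
move=> sgH phiM [l' imE] [l kerE].
pose lift y := xget 1 [set x | H x /\ phi x = y].
have liftP y : y \in l' -> H (lift y) /\ phi (lift y) = y.
  move=> /mem_generated; rewrite -imE => -[x Hx xy].
  by apply: (@xgetPex _ _ [set x | H x /\ phi x = y]); exists x.
pose K := generated (l ++ map lift l').
have KH : K `<=` H.
  apply: generated_min => // x; rewrite mem_cat => /orP[/mem_generated|/mapP[y yl' ->]].
    by rewrite -kerE => -[].
  by case: (liftP y yl').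
have sgK : is_subgroup K by exact: generated_subgroup.
have phiK : morph_on K phi by move=> x y /KH Hx /KH Hy; exact: phiM.
exists (l ++ map lift l'); apply/seteqP; split => // h Hh.
have : (phi @` K) (phi h).
  have : generated l' (phi h) by rewrite -imE; exists h.
  apply: generated_min; first exact: subgroup_image.
  move=> y yl'; exists (lift y); last by case: (liftP y yl').
  by apply: mem_generated; rewrite mem_cat map_f ?orbT.
move=> [k Kk kh]; rewrite -[h](mulVKg k); apply: (subgroupM sgK Kk).
have HkV := subgroupV sgH (KH _ Kk); have Hkh := subgroupM sgH HkV Hh.
have : (H `&` [set x | phi x = 1]) (k^-1 * h).
  split => //=; rewrite phiM//.
  by rewrite (morph_onV sgH)//; [rewrite kh mulVg|exact: KH].
rewrite kerE; apply: generated_min => // x xl.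
by apply: mem_generated; rewrite mem_cat xl.
Qed.

Lemma finite_fg (X : finType) (H : set {perm X}) :
  is_subgroup H -> finitely_generated H.
Proof.
move=> sgH; exists [seq p <- enum {perm X} | `[< H p >]].
apply/seteqP; split=> [p Hp|].
  by apply: mem_generated; rewrite mem_filter mem_enum andbT; exact/asboolP.
by apply: generated_min => // p; rewrite mem_filter => /andP[/asboolP].
Qed.

Definition amenable_fg (R : realType) (G : groupType) : Prop :=
  forall H : set G, is_subgroup H -> amenable R H -> finitely_generated H.

Lemma free_amenable_fg (R : realType) d : amenable_fg R (free_group d).
Proof.
move=> H sgH aH; have [z Hz Hcyc] := amenable_cyclic sgH aH.
exists [:: z]; apply/seteqP; split => [y /Hcyc[k yk]|]; last first.
  by apply: generated_min => // y; rewrite inE => /eqP ->.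
have sgz := generated_subgroup [:: z].
have zz : generated [:: z] z by apply: mem_generated; rewrite inE.
by case: yk => ->; [exact: (subgroupX k sgz zz)|exact: (subgroupV sgz (subgroupX k sgz zz))].
Qed.

(** The pointwise kernel of the action is filtered by the coordinates. *)
Lemma wreath_amenable_fg (R : realType) (X : finType) (G : groupType) :
  amenable_fg R G -> amenable_fg R (wreath X G).
Proof.
move=> fgG H sgH aH.
have supp (s : seq X) (K : set (wreath X G)) : is_subgroup K -> amenable R K ->
    (forall k, K k -> wact k =1 id /\ (forall x, x \notin s -> wlamp k x = 1)) ->
    finitely_generated K.
  elim: s K => [|x s IHs] K sgK aK Ks.
    exists [::]; apply/seteqP; split => [k Kk|]; last exact: generated_min.
    have [kid k1] := Ks k Kk.
    have -> : k = 1 by apply: wreath_ext => x; rewrite ?wact1 ?wlamp1// k1.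
    exact: (subgroup1 (generated_subgroup _)).
  have phiM : morph_on K (fun k => wlamp k x).
    by move=> g h _ Kh; rewrite wlampM (Ks h Kh).1.
  have sgker := subgroup_ker sgK phiM.
  apply: (fg_extension sgK phiM).
    apply: fgG; first exact: subgroup_image.
    exact: amenable_image.
  apply: IHs => //; first by apply: amenable_sub aK => // k [].
  move=> k [/Ks[kid ks] kx]; split => // y ys.
  by have [->//|yx] := eqVneq y x; apply: ks; rewrite inE negb_or yx.
have phiM : morph_on H (fun g => g.1^-1).
  move=> g h _ _; apply/permP => x.
  by rewrite -[(g * h).1]/(h.1 * g.1)%g invgM.
have sgker := subgroup_ker sgH phiM.
apply: (fg_extension sgH phiM); first by apply: finite_fg; exact: subgroup_image.
apply: (supp (enum X)) => //; first by apply: amenable_sub aH => // k [].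
move=> k [_ /= k1]; split => [x|x]; last by rewrite mem_enum.
by rewrite /wact -[k.1]invgK k1 invg1 perm1.
Qed.

End FinitelyGenerated.

Section WeightedSums.
Variable R : realType.
Local Open Scope ring_scope.

Definition wcost (X : finType) (G : groupType) (cost : G -> nat) (g : wreath X G) : nat :=
  (\sum_x cost (wlamp g x))%N.

Definition summable_cost (G : choiceType) (q : R) (cost : G -> nat) : Prop :=
  exists B : R, forall l : seq G, uniq l -> \sum_(g <- l) q ^+ cost g <= B.

(** The sum over the wreath product is the number of permutations times a product
    of sums over the coordinates. *)
Lemma wreath_summable_cost (X : finType) (G : groupType) (q : R) (cost : G -> nat) :
  0 <= q -> summable_cost q cost -> summable_cost q (@wcost X G cost).
Proof.
move=> q0 [B lB]; exists (#|{perm X}|%:R * \prod_(x : X) B) => l ul.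
pose V := undup (flatten [seq [seq wlamp g x | x <- enum X] | g <- l]).
have VP g x : g \in l -> wlamp g x \in V.
  move=> gl; rewrite mem_undup; apply/flattenP.
  by exists [seq wlamp g x | x <- enum X]; [exact: map_f|rewrite map_f// mem_enum].
(* Only the finitely many lamps in [V] occur in the list [l]. *)
pose T : finType := seq_sub V.
pose wt (f : {ffun X -> T}) := \prod_x q ^+ cost (ssval (f x)).
have wt0 f : 0 <= wt f by apply: prodr_ge0 => x _; exact: exprn_ge0.
have [->|] := eqVneq l [::].
  rewrite big_nil mulr_ge0// prodr_ge0// => _ _.
  by have := lB [::] isT; rewrite big_nil.
move=> lnil; have [g0 g0l] : exists g0, g0 \in l.
  by case: l lnil {ul V VP T wt wt0} => // g0 l _; exists g0; rewrite mem_head.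
pose code (g : wreath X G) : {perm X} * {ffun X -> T} :=
  (g.1, [ffun x => insubd (SeqSub (VP g0 x g0l)) (wlamp g x)]).
have codeE g x : g \in l -> ssval ((code g).2 x) = wlamp g x.
  by move=> gl; rewrite ffunE -[ssval _]/(val _) insubdK//; exact: (VP _ _ gl).
have code_inj : {in l &, injective code}.
  move=> g h gl hl gh; have pE : g.1 = h.1 := congr1 fst gh.
  apply: wreath_ext => x; first by rewrite /wact pE.
  by rewrite -!codeE// gh.
have -> : \sum_(g <- l) q ^+ wcost cost g = \sum_(p <- map code l) wt p.2.
  rewrite big_map; apply: eq_big_seq => g gl; rewrite /wcost /wt expr_sum.
  by apply: eq_bigr => x _; rewrite codeE.
have ucl : uniq (map code l) by rewrite map_inj_in_uniq.
rewrite big_uniq//=; apply: (@le_trans _ _ (\sum_(p : {perm X} * {ffun X -> T}) wt p.2)).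
  by rewrite [leRHS](bigID (mem (map code l)))/= lerDl sumr_ge0.
have -> : \sum_(p : {perm X} * {ffun X -> T}) wt p.2 = #|{perm X}|%:R * \sum_f wt f.
  rewrite -(pair_bigA _ (fun (_ : {perm X}) f => wt f))/= sumr_const mulr_natl.
  by congr (_ *+ _); apply: eq_card.
rewrite ler_wpM2l//.
rewrite /wt -(bigA_distr_bigA (fun x (t : T) => q ^+ cost (ssval t))).
apply: ler_prod => x _; rewrite sumr_ge0 => [/=|t _]; last exact: exprn_ge0.
have := lB V (undup_uniq _); apply: le_trans.
rewrite le_eqVlt; apply/orP; left; apply/eqP.
transitivity (\sum_(v <- map (@ssval _ _) (enum T)) q ^+ cost v).
  by rewrite big_map big_enum.
apply: perm_big; apply: uniq_perm; rewrite ?undup_uniq//.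
  by rewrite map_inj_uniq ?enum_uniq//; exact: val_inj.
move=> v; apply/mapP/idP => [[t _ ->]|vV]; first exact: (valP t).
by exists (SeqSub vV); rewrite ?mem_enum.
Qed.

(** There are at most [k ^ n] words of length [n] over [k] letters. *)
Lemma words_summable_cost (A : finType) (q : R) : 0 <= q -> #|A|%:R * q <= 2^-1 ->
  forall l : seq (seq A), uniq l -> \sum_(w <- l) q ^+ size w <= 2.
Proof.
move=> q0 Aq l ul; pose n := (\max_(w <- l) size w).+1.
have sz w : w \in l -> (size w < n)%N.
  by move=> wl; rewrite ltnS (big_rem w)//= leq_max leqnn.
have -> : \sum_(w <- l) q ^+ size w =
    \sum_(k < n) \sum_(w <- l | size w == k) q ^+ k.
  rewrite (exchange_big_dep xpredT)//=; apply: eq_big_seq => w wl.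
  rewrite (big_pred1 (Ordinal (sz w wl)))//.
apply: (@le_trans _ _ (\sum_(k < n) 2^-1 ^+ k)).
  apply: ler_sum => k _; rewrite -big_filter.
  pose L := [seq w <- l | size w == k].
  have uL : uniq L by exact: filter_uniq.
  have sL : (size L <= #|A| ^ k)%N.
    have sub : {subset L <= map val (enum {: k.-tuple A})}.
      move=> w; rewrite mem_filter => /andP[wk _]; apply/mapP.
      by exists (Tuple wk); rewrite ?mem_enum.
    by apply: leq_trans (uniq_leq_size uL sub) _; rewrite size_map -cardE card_tuple.
  rewrite big_const_seq count_predT iter_addr_0 -/L -[_ *+ size L]mulr_natl.
  apply: (@le_trans _ _ ((#|A| ^ k)%:R * q ^+ k)).
    by rewrite ler_wpM2r ?exprn_ge0// ler_nat.
  by rewrite natrX -exprMn lerXn2r// ?nnegrE ?mulr_ge0 ?invr_ge0.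
have -> : \sum_(k < n) (2^-1 : R) ^+ k = 2 * (1 - 2^-1 ^+ n).
  have := subrX1 (2^-1 : R) n; rewrite -[X in _ = X * _]opprB.
  have -> : (1 - 2^-1 : R) = 2^-1 by field.
  by move=> h; rewrite -opprB h; field.
rewrite -subr_ge0 -[2 in X in X - _]mulr1 -mulrBr opprB addrC subrK.
by rewrite mulr_ge0// exprn_ge0// invr_ge0.
Qed.

Lemma free_summable_cost (k : nat) :
  summable_cost ((4 * k.+1)%:R^-1 : R) (fun g : free_group k => size (fg_word g)).
Proof.
exists 2 => l ul; rewrite -(big_map (@fg_word k) xpredT (fun w => _ ^+ size w)).
apply: words_summable_cost; rewrite ?invr_ge0//; last first.
  by rewrite map_inj_uniq//; exact: val_inj.
rewrite card_prod card_ord card_bool ler_pdivrMr ?ltr0n// -ler_pdivrMl ?invr_gt0//.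
by rewrite invrK -natrM ler_nat; lia.
Qed.

End WeightedSums.
(** * A tower of wreath products carrying truncations of the Grigorchuk group *)

Inductive gletter := La | Lb | Lc | Ld.

Definition is_a (l : gletter) : bool := if l is La then true else false.

Section Tower.
Local Open Scope group_scope.

Definition swap_perm : {perm bool} := perm (can_inj negbK).

Definition flip (f1 f2 : bool) (p : bool * bool) := (f1 (+) p.1, f2 (+) p.2).

Lemma flip_inj f1 f2 : injective (flip f1 f2).
Proof. by apply: (can_inj (g := flip f1 f2)) => -[p1 p2]; rewrite /flip /= !addKb. Qed.

Definition flip_perm f1 f2 : {perm bool * bool} := perm (@flip_inj f1 f2).

Fixpoint tower (k : nat) : groupType :=
  if k is k'.+1 then wreath bool (tower k') else wreath (bool * bool)%type (free_group 2).

(** In the base, [a] runs along two edges; traversed forward, these carry the two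
    free generators, and backward their inverses. *)
Definition base_lamp (p : bool * bool) : free_group 2 :=
  let g := fg_gen (if p.1 then ord_max else ord0) in if p.2 then g^-1 else g.

(** The recursion is that of the Grigorchuk group: [a] exchanges the coordinates,
    [b = (a, c)], [c = (a, d)] and [d = (1, b)]. At the base, [b], [c] and [d]
    are the translations of the Klein group, and [a b] fixes every point, with
    lamps of infinite order. *)
Fixpoint gen (k : nat) : gletter -> tower k :=
  if k is k'.+1 return gletter -> tower k then fun l =>
    match l with
    | La => wmk swap_perm (fun=> 1)
    | Lb => wmk 1 (fun h : bool => gen k' (if h then Lc else La))
    | Lc => wmk 1 (fun h : bool => gen k' (if h then Ld else La))
    | Ld => wmk 1 (fun h : bool => if h then gen k' Lb else 1)
    end
  else fun l =>
    match l with
    | La => wmk (flip_perm false true) base_lamp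
    | Lb => wmk (flip_perm false true) (fun=> 1)
    | Lc => wmk (flip_perm true false) (fun=> 1)
    | Ld => wmk (flip_perm true true) (fun=> 1)
    end.

Definition tev k (W : seq gletter) : tower k := \prod_(l <- W) gen k l.

Lemma tev_nil k : tev k [::] = 1. Proof. exact: big_nil. Qed.
Lemma tev_cons k l W : tev k (l :: W) = gen k l * tev k W. Proof. exact: big_cons. Qed.
Lemma tev_cat k V W : tev k (V ++ W) = tev k V * tev k W. Proof. exact: big_cat. Qed.

Lemma gen_relations k :
  (forall l, gen k l * gen k l = 1) /\ gen k Lb * gen k Lc = gen k Ld.
Proof.
elim: k => [|k [sq bc]].
  split.
    case; apply: wreath_ext => -[p1 p2]; rewrite ?wactM ?wlampM ?wact1 ?wlamp1
      ?wact_mk ?wlamp_mk ?permE /flip /= ?addKb ?negbK ?mulg1// /base_lamp /=.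
    by case: p2; rewrite ?mulgV ?mulVg.
  by apply: wreath_ext => -[p1 p2]; rewrite ?wactM ?wlampM ?wact1 ?wlamp1
      ?wact_mk ?wlamp_mk ?permE /flip /= ?mulg1 ?permE.
split.
  case; apply: wreath_ext => -[]; rewrite ?wactM ?wlampM ?wact1 ?wlamp1
    ?wact_mk ?wlamp_mk ?permE ?wact_mk ?permE /= ?wlamp_mk ?sq ?mulg1//.
have cE : gen k Lc = gen k Lb * gen k Ld by rewrite -bc mulgA sq mul1g.
apply: wreath_ext => -[]; rewrite ?wactM ?wlampM ?wact1 ?wlamp1
    ?wact_mk ?wlamp_mk ?permE ?wact_mk ?permE /= ?wlamp_mk ?sq ?mulg1//.
have cd : gen k Lc * gen k Ld = gen k Lb by rewrite cE -mulgA sq mulg1.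
exact: cd.
Qed.

Lemma gen_sq k l : gen k l * gen k l = 1. Proof. exact: (gen_relations k).1. Qed.

Lemma genV k l : (gen k l)^-1 = gen k l.
Proof. by apply/mulg1_eq; exact: gen_sq. Qed.

(** The product in the Klein group [{1, b, c, d}], as a word of length at most one;
    a pair involving [a] is left as it is. *)
Definition klein (x y : gletter) : seq gletter :=
  match x, y with
  | Lb, Lc | Lc, Lb => [:: Ld]
  | Lb, Ld | Ld, Lb => [:: Lc]
  | Lc, Ld | Ld, Lc => [:: Lb]
  | Lb, Lb | Lc, Lc | Ld, Ld => [::]
  | La, y => [:: La; y]
  | x, La => [:: x; La]
  end.

Lemma gen_klein k x y : tev k (klein x y) = gen k x * gen k y.
Proof.
have [sq bc] := gen_relations k; have V := genV k.
have cb : gen k Lc * gen k Lb = gen k Ld by rewrite -[RHS]V -bc invgM !V.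
have bd : gen k Lb * gen k Ld = gen k Lc by rewrite -bc mulgA sq mul1g.
have db : gen k Ld * gen k Lb = gen k Lc by rewrite -cb -mulgA sq mulg1.
have cd : gen k Lc * gen k Ld = gen k Lb by rewrite -cb mulgA sq mul1g.
have dc : gen k Ld * gen k Lc = gen k Lb by rewrite -bc -mulgA sq mulg1.
by case: x y => -[]; rewrite /= ?tev_cons ?tev_nil ?sq ?mulg1.
Qed.

End Tower.

(** ** Contraction *)

Section Contraction.

(** The weights satisfy the triangle inequalities of the Klein group, and
    [10 * (a + c) <= 9 * (a + b)], [10 * (a + d) <= 9 * (a + c)] and
    [10 * b <= 9 * (a + d)]: a letter [b], [c] or [d] and the [a] next to it lose
    at least a tenth of their weight when replaced by their coordinates. *)
Definition weight (l : gletter) : nat :=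
  match l with La => 30 | Lb => 70 | Lc => 60 | Ld => 51 end.

Definition word_weight (W : seq gletter) : nat := \sum_(l <- W) weight l.

Definition alternating (W : seq gletter) : bool :=
  sorted (fun l l' => is_a l != is_a l') W.

Lemma word_weight_cons l W : word_weight (l :: W) = (weight l + word_weight W)%N.
Proof. exact: big_cons. Qed.

Lemma word_weight_cat V W : word_weight (V ++ W) = (word_weight V + word_weight W)%N.
Proof. exact: big_cat. Qed.

(** The triangle inequalities make the shortening of a word to an alternating one
    harmless. *)
Lemma alternating_word W : exists W', [/\ alternating W',
  (word_weight W' <= word_weight W)%N & forall k, tev k W' = tev k W].
Proof.
elim: W => [|l W [W' [altW' wW' evW']]]; first by exists [::].
case: W' altW' wW' evW' => [|l' W'] altW' wW' evW'.
  exists [:: l]; split => [//||k]; last by rewrite !tev_cons evW'.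
  by rewrite !word_weight_cons leq_add2l.
have [ll'|ll'] := boolP (is_a l != is_a l').
  exists [:: l, l' & W']; split => [||k]; last by rewrite !tev_cons -evW' tev_cons.
    by rewrite /alternating /= ll'.
  by rewrite word_weight_cons [leqRHS]word_weight_cons leq_add2l.
rewrite negbK in ll'.
have altW : alternating W' by exact: path_sorted altW'.
have ev2 k : (gen k l * tev k W)%g = (gen k l * gen k l' * tev k W')%g.
  by rewrite -evW' tev_cons mulgA.
rewrite word_weight_cons in wW'.
have [/eqP a_l|na_l] := boolP (is_a l).
  exists W'; split => // [|k]; first by rewrite word_weight_cons; lia.
  by case: l l' a_l ll' {altW' wW' evW'} ev2 => -[]// _ _ ev2; rewrite tev_cons ev2 gen_sq mul1g.
exists (klein l l' ++ W'); split => [||k].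
- case: W' altW' {altW wW' evW' ev2} => [|l2 W'] altW'.
    by case: l l' ll' na_l {altW'} => -[].
  by move: altW'; rewrite /alternating /=; case: l l' ll' na_l => -[]//=;
     case: l2 => //= _ _ /andP[].
- rewrite word_weight_cat word_weight_cons.
  suff : (word_weight (klein l l') <= weight l + weight l')%N by lia.
  by case: l l' ll' na_l {altW' wW' evW' ev2} => -[]//; rewrite /= ?word_weight_cons /word_weight ?big_nil.
- by rewrite tev_cat gen_klein tev_cons ev2.
Qed.

Definition sect (h : bool) (l : gletter) : seq gletter :=
  match l, h with
  | Lb, false | Lc, false => [:: La]
  | Lb, true => [:: Lc] | Lc, true => [:: Ld] | Ld, true => [:: Lb]
  | _, _ => [::]
  end.

Fixpoint word_sect (h : bool) (W : seq gletter) : seq gletter :=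
  if W is l :: W' then sect (h (+) odd (count is_a W')) l ++ word_sect h W' else [::].

Lemma wact_gen k l (h : bool) : wact (gen k.+1 l : wreath bool (tower k)) h = h (+) is_a l.
Proof. by case: l; rewrite /= wact_mk permE ?addbT ?addbF. Qed.

Lemma wlamp_gen k l (h : bool) :
  wlamp (gen k.+1 l : wreath bool (tower k)) h = tev k (sect h l).
Proof.
by case: l h => -[]; rewrite /= wlamp_mk ?tev_cons tev_nil ?mulg1.
Qed.

Lemma wact_tev k W (h : bool) :
  wact (tev k.+1 W : wreath bool (tower k)) h = h (+) odd (count is_a W).
Proof.
elim: W => [|l W IHW]; first by rewrite tev_nil wact1 addbF.
by rewrite tev_cons [LHS]wactM IHW wact_gen /= oddD addbA oddb addbAC.
Qed.

Lemma wlamp_tev k W (h : bool) :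
  wlamp (tev k.+1 W : wreath bool (tower k)) h = tev k (word_sect h W).
Proof.
elim: W => [|l W IHW]; first by rewrite tev_nil wlamp1 tev_nil.
by rewrite tev_cons [LHS]wlampM IHW wact_tev wlamp_gen -tev_cat.
Qed.

(** Separating two letters of the Klein group takes a letter [a]. *)
Lemma alternating_count W : alternating W ->
  (count (predC is_a) W <= (count is_a W).+1)%N.
Proof.
suff: alternating W -> (count (predC is_a) W <= count is_a W +
    (if W is l :: _ then ~~ is_a l else false))%N.
  by move=> h /h /leq_trans; apply; case: W {h} => [|l W]; lia.
elim: W => // l W IHW altW; have := IHW (path_sorted altW).
case: W altW {IHW} => [|l' W] /=; first by case: (is_a l).
by move=> /andP[+ _]; case: (is_a l); case: (is_a l') => //=; lia.
Qed.

Lemma word_sect_contract W : alternating W ->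
  (10 * (word_weight (word_sect false W) + word_weight (word_sect true W))
    <= 9 * (word_weight W + 30))%N.
Proof.
(* Each letter of the Klein group borrows a letter [a], of weight 30, and
   [270 = 9 * 30]. *)
move=> /alternating_count.
suff : (10 * (word_weight (word_sect false W) + word_weight (word_sect true W)) +
    270 * count is_a W <= 9 * word_weight W + 270 * count (predC is_a) W)%N by lia.
elim: W => [|l W IHW]; first by rewrite /word_weight !big_nil.
rewrite /= !word_weight_cat word_weight_cons.
move: (word_weight _) (word_weight _) (word_weight W) (count is_a W) (count _ W) IHW => u v w m n IHW.
by case: (odd _); case: l => /=; rewrite /word_weight ?big_nil ?big_cons ?big_nil /=; lia.
Qed.

Lemma size_fgM d (x y : free_group d) :
  (size (fg_word (x * y)%g) <= size (fg_word x) + size (fg_word y))%N.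
Proof.
have [a [b [c [-> -> ->]]]] := fg_wordM_cancel x y.
by rewrite !size_cat; lia.
Qed.

Fixpoint tower_cost (k : nat) : tower k -> nat :=
  if k is k'.+1 return tower k -> nat
  then @wcost bool (tower k') (@tower_cost k')
  else @wcost (bool * bool)%type (free_group 2) (fun g => size (fg_word g)).

Lemma tower_cost_base W : (tower_cost (tev 0 W) <= word_weight W)%N.
Proof.
have lampW (p : bool * bool) : (size (fg_word (wlamp (tev 0 W : wreath _ _) p)) <= count is_a W)%N.
  elim: W p => [|l W IHW] p; first by rewrite tev_nil wlamp1.
  rewrite tev_cons [wlamp _ _]wlampM (leq_trans (size_fgM _ _))//= leq_add//.
  move: (wact _ _) => q; case: l => /=; rewrite wlamp_mk// /base_lamp.
  by case: q.2.
apply: (@leq_trans (\sum_(p : bool * bool) count is_a W)).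
  by apply: leq_sum => p _; exact: lampW.
rewrite sum_nat_const card_prod card_bool.
elim: W {lampW} => [|l W IHW]; first by rewrite muln0.
by rewrite word_weight_cons /=; case: l => /=; lia.
Qed.

(** The cost of an element is the sum of the costs of its two coordinates, whose
    words contract once the word is made alternating. *)
Lemma tower_cost_contract k : exists C : nat, forall W,
  (10 ^ k * tower_cost (tev k W) <= 9 ^ k * word_weight W + C)%N.
Proof.
elim: k => [|k [C costC]].
  by exists 0%N => W; rewrite !expn0 !mul1n addn0; exact: tower_cost_base.
exists (9 ^ k.+1 * 30 + 20 * C)%N => W.
have [W' [altW' wW' <-]] := alternating_word W.
have -> : tower_cost (tev k.+1 W') = (tower_cost (tev k (word_sect true W')) +
    tower_cost (tev k (word_sect false W')))%N.
  by rewrite [LHS]/= /wcost big_bool !wlamp_tev.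
have := word_sect_contract altW'; have := costC (word_sect true W').
have := costC (word_sect false W'); rewrite !expnS.
move: (tower_cost _) (tower_cost _) (word_weight (word_sect _ _)) (word_weight (word_sect _ _)) => u v x y.
move: (10 ^ k)%N (9 ^ k)%N => e n; nia.
Qed.

Lemma tower_summable_cost (R : realType) k :
  summable_cost ((12%:R)^-1 : R)%R (@tower_cost k).
Proof.
by elim: k => [|k IHk]; apply: wreath_summable_cost; rewrite ?invr_ge0//; exact: free_summable_cost.
Qed.

Lemma tower_amenable_fg (R : realType) k : amenable_fg R (tower k).
Proof.
by elim: k => [|k IHk]; apply: wreath_amenable_fg => //; exact: free_amenable_fg.
Qed.

End Contraction.

(** ** Rigidity *)

Section TowerRigid.
Local Open Scope group_scope.

(** The normal closure of [(a b)^2]; its image in the Grigorchuk group is the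
    subgroup over which that group is regularly branch. *)
Inductive branch (k : nat) : tower k -> Prop :=
| branch_abab : branch (tev k [:: La; Lb; La; Lb])
| branchM x y : branch x -> branch y -> branch (x * y)
| branchJ x l : branch x -> branch (gen k l * x * gen k l).

(** With [k = (a b)^2] and [b d = d b], this word is [(b a d) k (b a d)^-1 * b k b]. *)
Lemma branch_commutator k : branch (tev k [:: Lb; La; Ld; La; Lb; La; Ld; La]).
Proof.
have bd : gen k Lb * gen k Ld = gen k Ld * gen k Lb.
  by rewrite -!gen_klein.
have := branchM (branchJ Lb (branchJ La (branchJ Ld (branch_abab k))))
  (branchJ Lb (branch_abab k)).
congr branch; rewrite !tev_cons !tev_nil mulg1.
have sq l z : gen k l * (gen k l * z) = z by rewrite mulgA gen_sq mul1g.
rewrite -!mulgA !(gen_sq, sq, mulg1).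
by rewrite [gen k Lb * (gen k Ld * _)]mulgA bd -!mulgA !sq.
Qed.

(** As [a d a = (b, 1)] and [b = (a, c)], the commutator [[b, a d a]] is
    [((a b)^2, 1)]. Elements fixing the first coordinate have arbitrary lamps
    there, so that conjugating by them gives the whole branch subgroup. *)
Lemma branch_at k (h : bool) s : branch s -> @branch k.+1 (wat h s).
Proof.
have conj (g : tower k.+1) x : wact (g : wreath bool _) false = false ->
    g * wat false x * g^-1 =
    wat false (wlamp (g : wreath bool _) false * x * (wlamp (g : wreath bool _) false)^-1).
  by move=> gf; rewrite [LHS]conj_wat gf conjgE invgK mulgA.
have left x : branch x -> @branch k.+1 (wat false x).
  elim=> {x} [|x y _ bx _ Hby|x l _ bx].
  - have := branch_commutator k.+1; congr branch.
    apply: wreath_ext => -[]; rewrite ?wact_tev ?wact_at ?wlamp_tev ?wlamp_at//=.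
    by rewrite !tev_cons tev_nil mulg1 gen_sq.
  - by rewrite watM; exact: branchM.
  - have [V Vf Vl] : exists2 V, wact (tev k.+1 V : wreath bool _) false = false &
        wlamp (tev k.+1 V : wreath bool _) false = gen k l.
      exists (match l with La => [:: Lb] | Lb => [:: La; Ld; La]
        | Lc => [:: La; Lb; La] | Ld => [:: La; Lc; La] end).
        by rewrite wact_tev; case: l.
      by rewrite wlamp_tev; case: l; rewrite /= tev_cons tev_nil mulg1.
    have := conj (tev k.+1 V) x Vf; rewrite Vl genV => <-.
    elim: V {Vf Vl} => [|l' V IHV]; first by rewrite tev_nil invg1 mulg1 mul1g.
    rewrite tev_cons invgM genV; have := branchJ l' IHV.
    by rewrite !mulgA.
move=> /left; case: h => // bs; have := branchJ La bs.
rewrite -{2}[gen k.+1 La]genV [X in branch X]conj_wat /=.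
by rewrite wact_mk permE wlamp_mk invg1 conjg1.
Qed.

(** The homomorphism to the integers with values 1 and 2 on the two generators. *)
Definition height (w : seq (letter 2)) : int :=
  (\sum_(l <- w) (if l.2 then - (l.1.+1)%:Z else (l.1.+1)%:Z))%R.

Lemma heightM (x y : free_group 2) :
  height (fg_word (x * y)) = (height (fg_word x) + height (fg_word y))%R.
Proof.
change (fg_word (x * y)) with (foldr (@push 2) (fg_word y) (fg_word x)).
elim: (fg_word x) => [|l u IHu]; first by rewrite /height big_nil add0r.
rewrite [in RHS]/height big_cons -/(height u) -addrA -IHu /=.
case: (foldr _ _ _) => [|l' w] /=; first by rewrite /height big_cons.
case: eqVneq => [->|_]; rewrite /height ?big_cons//.
by case: l => i [] /=; rewrite addrA ?addNr ?subrr add0r.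
Qed.

(** [wact] and [wlamp] for the group structure of [tower 0], which is a wreath
    product only up to conversion. *)
Definition bact (g : tower 0) p := wact (g : wreath (bool * bool)%type (free_group 2)) p.
Definition blamp (g : tower 0) p := wlamp (g : wreath (bool * bool)%type (free_group 2)) p.

Lemma bactM g h p : bact (g * h) p = bact g (bact h p). Proof. exact: wactM. Qed.
Lemma blampM g h p : blamp (g * h) p = blamp g (bact h p) * blamp h p.
Proof. exact: wlampM. Qed.
Lemma bact1 p : bact 1 p = p. Proof. exact: wact1. Qed.
Lemma blamp1 p : blamp 1 p = 1. Proof. exact: wlamp1. Qed.
Lemma bact_fixV g p : bact g p = p -> bact g^-1 p = p.
Proof. by move=> gp; rewrite -{1}gp; exact: wactK. Qed.
Lemma blamp_fixV g p : bact g p = p -> blamp g^-1 p = (blamp g p)^-1.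
Proof. by move=> /bact_fixV gp; rewrite -{2}gp; exact: wlampV. Qed.
Lemma base_ext g h : bact g =1 bact h -> blamp g =1 blamp h -> g = h.
Proof. exact: wreath_ext. Qed.

Lemma bact_gen l p : bact (gen 0 l) p =
  match l with La | Lb => (p.1, ~~ p.2) | Lc => (~~ p.1, p.2) | Ld => (~~ p.1, ~~ p.2) end.
Proof. by case: l p => -[p1 p2]; rewrite /bact /= wact_mk permE. Qed.

Lemma blamp_gen l p : blamp (gen 0 l) p = if l is La then base_lamp p else 1.
Proof. by case: l; rewrite /blamp /= wlamp_mk. Qed.

Let abab : tower 0 := tev 0 [:: La; Lb; La; Lb].
Let abab' : tower 0 := gen 0 Lc * abab * gen 0 Lc.

Definition abab_lamp (p : bool * bool) : free_group 2 :=
  let g := fg_gen (if p.1 then ord_max else ord0) in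
  if p.2 then g * g else g^-1 * g^-1.

Lemma bact_abab p : bact abab p = p.
Proof. by rewrite /abab !tev_cons tev_nil mulg1 !bactM !bact_gen /= !negbK; case: p. Qed.

Lemma blamp_abab p : blamp abab p = abab_lamp p.
Proof.
rewrite /abab !tev_cons tev_nil mulg1 !blampM !bactM !bact_gen !blamp_gen.
by rewrite /base_lamp /abab_lamp /= !mulg1 !mul1g !negbK; case: p.2.
Qed.

Lemma bact_abab' p : bact abab' p = p.
Proof. by rewrite /abab' !bactM bact_abab !bact_gen /= negbK; case: p. Qed.

Lemma blamp_abab' p : blamp abab' p = abab_lamp (~~ p.1, p.2).
Proof.
by rewrite /abab' !blampM bact_abab !bact_gen blamp_abab !blamp_gen mulg1 mul1g.
Qed.

Lemma abab_lamp_not_commute p :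
  ~ commute (abab_lamp p ^+ 2) (abab_lamp (~~ p.1, p.2) ^+ 2).
Proof.
move=> /(congr1 (fun x => fg_word x)) /eqP.
by case: p => -[] []; vm_compute.
Qed.

Lemma height_abab_lamp_inj : injective (fun p => height (fg_word (abab_lamp p))).
Proof.
have hgen (i : 'I_2) : height (fg_word (fg_gen i)) = Posz i.+1 by rewrite /height big_seq1.
have hgenV (i : 'I_2) : height (fg_word (fg_gen i)^-1) = (- Posz i.+1)%R.
  by rewrite /height big_seq1.
have ht b : height (fg_word (abab_lamp (b, true))) = (if b then 4 else 2)%R.
  by rewrite -[abab_lamp _]/(fg_gen _ * fg_gen _) heightM !hgen; case: b.
have hf b : height (fg_word (abab_lamp (b, false))) = (if b then -4 else -2)%R.
  by rewrite -[abab_lamp _]/((fg_gen _)^-1 * (fg_gen _)^-1) heightM !hgenV; case: b.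
by move=> [b []] [b' []]; rewrite ?ht ?hf; case: b; case: b'.
Qed.

(** The lamps of [(a b)^2] and of its conjugate by [c] at a point are powers of
    the two free generators, so that the lamps of [N] at its fixed points are
    trivial. Then [N] commutes with [(a b)^2], whose lamps at the four points have
    pairwise distinct heights, hence are not conjugate: [N] fixes every point. *)
Lemma base_rigid (R : realType) : amenably_rigid R (@branch 0).
Proof.
move=> N sgN aN nN.
have kappa : branch abab by exact: branch_abab.
have kappa' : branch abab' by exact: branchJ.
pose lamps p := (fun n => blamp n p) @` (N `&` [set n | bact n p = p]).
have conj p n g : N n -> bact n p = p -> (forall q, bact g q = q) ->
    N (n ^ g) -> lamps p (blamp n p ^ blamp g p).
  move=> Nn np gid Nng; exists (n ^ g); first split => //=.
    by rewrite conjgE !bactM gid np bact_fixV.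
  by rewrite !conjgE !blampM !bactM gid np blamp_fixV.
have lamp1 p n : N n -> bact n p = p -> blamp n p = 1.
  move=> Nn np; have [sgN' aN'] := @amenable_wlamp R _ _ N p sgN aN.
  suff N'1 : lamps p = [set 1].
    suff : [set 1] (blamp n p) by [].
    by rewrite -N'1; exists n.
  apply: (amenable_normalizer (g := abab_lamp p) (h := abab_lamp (~~ p.1, p.2)) sgN' aN').
    move=> _ [m [Nm mp] <-]; rewrite -blamp_abab -blamp_abab'.
    rewrite -!blamp_fixV ?bact_abab ?bact_abab'//.
    have [k1 k2] := nN _ _ kappa Nm; have [k3 k4] := nN _ _ kappa' Nm.
    by split; apply: conj => // q; rewrite ?bact_fixV ?bact_abab ?bact_abab'.
  exact: abab_lamp_not_commute.
have fixed n : N n -> forall p, bact n p = p.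
  move=> Nn p; pose c : tower 0 := n^-1 * n ^ abab^-1.
  have Nc : N c.
    apply: (subgroupM sgN); first exact: subgroupV.
    by case: (nN _ _ kappa Nn).
  have cid q : bact c q = q.
    rewrite /c conjgE invgK !bactM bact_abab (bact_fixV (bact_abab q)).
    exact: wactK.
  have c1 : c = 1.
    by apply: base_ext => q; rewrite ?bact1 ?cid// blamp1 lamp1.
  have nk : abab * n = n * abab.
    apply: (@mulIg _ abab^-1); rewrite mulgK; apply: (@mulgI _ n^-1).
    by rewrite mulVg -c1 /c conjgE invgK -mulgA.
  have := congr1 (fun g => blamp g p) nk; rewrite !blampM bact_abab !blamp_abab.
  move=> /(congr1 (fun x => height (fg_word x))); rewrite !heightM addrC.
  by move=> /addrI /height_abab_lamp_inj.
by move=> n Nn; apply: base_ext => p; rewrite ?bact1 ?blamp1 ?lamp1// fixed.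
Qed.

Lemma branch_neq1 k : exists2 s, @branch k s & s <> 1.
Proof.
elim: k => [|k [s bs s1]].
  exists abab; first exact: branch_abab.
  move=> /(congr1 (fun g => fg_word (blamp g (true, true)))) /eqP.
  by rewrite blamp_abab blamp1; vm_compute.
exists (wat false s); first exact: branch_at.
move=> /(congr1 (fun g : wreath bool _ => wlamp g false)).
by rewrite /= wlamp_at wlamp1.
Qed.

Lemma tower_rigid (R : realType) k : amenably_rigid R (@branch k).
Proof.
elim: k => [|k IHk]; first exact: base_rigid.
apply: (wreath_rigid IHk); first exact: branch_neq1.
by move=> h s; exact: branch_at.
Qed.

End TowerRigid.
(** * The free group acting on a ball of its Cayley tree *)

Section BallWords.
Variables (d r : nat).
Implicit Types (l : letter d) (w : seq (letter d)).

Fixpoint flip_head (i : 'I_d) w : seq (letter d) :=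
  if w is l :: w' then if l.1 == i then letter_inv l :: flip_head i w' else w
  else [::].

Lemma size_flip_head i w : size (flip_head i w) = size w.
Proof. by elim: w => //= l w IHw; case: eqP => //= _; rewrite IHw. Qed.

Lemma flip_headK i : involutive (flip_head i).
Proof.
elim=> //= l w IHw; have [li|li] := eqVneq l.1 i; last by rewrite /= (negPf li).
by rewrite /= li eqxx IHw letter_invK.
Qed.

Lemma reduced_flip_head i w : reduced w -> reduced (flip_head i w).
Proof.
rewrite /reduced; set e := (fun l l' => _).
have pathV w' l : l.1 = i -> path e l w' -> path e (letter_inv l) (flip_head i w').
  elim: w' l => //= l' w' IHw l li /andP[ll' pw'].
  case: eqP => [l'i|l'i] /=.
    by rewrite IHw// andbT /e (inj_eq (can_inj (@letter_invK d))).
  by rewrite pw' andbT /e letter_invK; apply: contra_notN l'i => /eqP ->.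
by case: w => //= l w; case: eqP => // li /pathV; exact.
Qed.

Lemma letter_inv_neq l : letter_inv l != l.
Proof. by apply/eqP => /(congr1 snd) /=; case: l.2. Qed.

(** Left multiplication by a letter, where the path [l^-j u, ..., l^j u] leaving
    the ball of radius [r] is closed up into a cycle, of odd length [2 j + 1]. *)
Definition step l w : seq (letter d) :=
  if (size (push l w) <= r)%N then push l w else flip_head l.1 w.

Lemma pushP l w : (exists w', w = letter_inv l :: w' /\ push l w = w') \/
  push l w = l :: w.
Proof.
case: w => [|l' w]; first by right.
by rewrite /=; case: eqP => [->|_]; [left; exists w|right].
Qed.

Lemma reduced_step l w : reduced w -> reduced (step l w).
Proof.
by rewrite /step; case: ifP => _; [exact: reduced_push|exact: reduced_flip_head].
Qed.

Lemma size_step l w : (size w <= r)%N -> (size (step l w) <= r)%N.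
Proof. by rewrite /step; case: ifP => // _; rewrite size_flip_head. Qed.

Lemma stepK l w : reduced w -> (size w <= r)%N -> step (letter_inv l) (step l w) = w.
Proof.
move=> rw sw; rewrite {2}/step; case: ifPn => [pr|]; first by rewrite /step pushK// sw.
case: (pushP l w) => [[w' [wE ->]]|pE pr].
  by rewrite wE /= in sw; rewrite (ltnW sw).
suff pE' : push (letter_inv l) (flip_head l.1 w) = letter_inv l :: flip_head l.1 w.
  rewrite /step pE'; rewrite pE in pr; rewrite /= size_flip_head.
  by rewrite (negPf pr) flip_headK.
case: w {rw sw pr} pE => //= l' w.
case: eqP => [_ /(congr1 size) /=|l'l _]; first by lia.
have [ll'|ll'] := eqVneq l'.1 l.1; last first.
  by rewrite /= letter_invK; case: eqP => // l'E; rewrite l'E eqxx in ll'.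
have -> : l' = l.
  case: l l' ll' l'l => i b [i' b'] /= -> l'l; congr pair.
  by case: b b' l'l => -[].
by rewrite /= letter_invK (negPf (letter_inv_neq l)).
Qed.

Lemma foldr_step w : reduced w -> (size w <= r)%N -> foldr step [::] w = w.
Proof.
elim: w => //= l w IHw rw sw; rewrite IHw ?(ltnW sw)//; last exact: path_sorted rw.
rewrite /step; case: (pushP l w) => [[w' [wE _]]|->]; last by rewrite /= sw.
by move: rw; rewrite wE /reduced /= eqxx.
Qed.

Definition avoids (i : 'I_d) w : bool := if w is l :: _ then l.1 != i else true.

Section Cycles.
Variables (i : 'I_d) (u : seq (letter d)) (b : bool).
Hypotheses (ru : reduced u) (su : (size u <= r)%N)
  (hu : avoids i u).
Let j := (r - size u)%N.
Let a : letter d := (i, b).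

Lemma flip_head_nseq c n : flip_head i (nseq n (i, c) ++ u) = nseq n (i, ~~ c) ++ u.
Proof.
elim: n => [|n IHn] /=; last by rewrite eqxx IHn.
by case: u hu => //= l u' /negPf ->.
Qed.

Lemma push_nseq n : push a (nseq n a ++ u) = nseq n.+1 a ++ u.
Proof.
case: n => [|n] /=; last by rewrite eq_sym (negPf (letter_inv_neq _)).
case: u hu => // l u' li; rewrite /push; case: eqP => // lE.
by move: li; rewrite lE /= eqxx.
Qed.

Lemma iter_step_up n : (n <= j)%N -> iter n (step a) u = nseq n a ++ u.
Proof.
elim: n => // n IHn nj; rewrite iterS IHn 1?ltnW// /step push_nseq.
by rewrite size_cat size_nseq; case: ifP => //; rewrite /j in nj *; lia.
Qed.

Lemma iter_step_down n : (n <= j)%N ->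
  iter n (step a) (nseq j (i, ~~ b) ++ u) = nseq (j - n) (i, ~~ b) ++ u.
Proof.
elim: n => [|n IHn] nj; first by rewrite subn0.
rewrite iterS IHn 1?ltnW//; have -> : (j - n)%N = (j - n.+1).+1 by lia.
rewrite /step /= /letter_inv /= eqxx size_cat size_nseq.
by case: ifP => //; rewrite /j in nj *; lia.
Qed.

Lemma iter_step_cycle n : (n <= j)%N ->
  iter (j + j).+1 (step a) (nseq n a ++ u) = nseq n a ++ u.
Proof.
move=> nj; have cyc : iter (j + j).+1 (step a) u = u.
  rewrite -addnS iterD iterS (iter_step_up (leqnn j)).
  have -> : step a (nseq j a ++ u) = nseq j (i, ~~ b) ++ u.
    rewrite /step push_nseq flip_head_nseq size_cat size_nseq.
    by case: ifP => //; rewrite /j; lia.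
  by rewrite iter_step_down// subnn.
by rewrite -(iter_step_up nj) -iterD addnC iterD cyc.
Qed.

End Cycles.

Lemma head_decomposition i w : reduced w ->
  exists b n (u : seq (letter d)), [/\ w = nseq n (i, b) ++ u,
  reduced u & avoids i u].
Proof.
elim: w => [|l w IHw] rw; first by exists true, 0%N, [::].
have [li|li] := eqVneq l.1 i; last by exists true, 0%N, (l :: w).
have [b [n [u [wE ru hu]]]] := IHw (path_sorted rw).
case: n wE => [|n] wE.
  by exists l.2, 1%N, u; split => //=; rewrite wE -li; case: (l).
exists b, n.+2, u; split => //; rewrite wE /=; congr (_ :: _).
move: rw; rewrite wE /reduced /= => /andP[+ _].
by case: l li => i' b' /= ->; rewrite /letter_inv /=; case: (b) b' => -[] //; rewrite eqxx.
Qed.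

(** All cycles have odd length, so that an odd power of a generator acts trivially
    on the ball; it keeps the lamps of order two. *)
Lemma step_odd_cycle i w : reduced w -> (size w <= r)%N ->
  exists n, iter n.*2.+1 (step (i, false)) w = w.
Proof.
move=> rw sw; have [b [n [u [wE ru hu]]]] := head_decomposition i rw.
rewrite wE size_cat size_nseq in sw.
have su : (size u <= r)%N by lia.
have nj : (n <= r - size u)%N by lia.
exists (r - size u)%N; rewrite -addnn wE.
case: b {wE}; last exact: (iter_step_cycle false ru su hu nj).
have <- : iter (r - size u - n) (step (i, false))
    (nseq (r - size u) (i, true) ++ u) = nseq n (i, true) ++ u.
  by have := iter_step_down false ru su hu (leq_subr n _); rewrite subKn.
set v := nseq _ _ ++ u; have vE : v = iter (r - size u).+1 (step (i, false)) u.
  rewrite iterS iter_step_up// /step push_nseq// flip_head_nseq// size_cat size_nseq.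
  by case: ifP => //; lia.
set A := (_ + _).+1.
have cyc : iter A (step (i, false)) u = u.
  exact: (iter_step_cycle false ru su hu (leq0n _)).
have shift B x : iter A (step (i, false)) x = x ->
    iter A (step (i, false)) (iter B (step (i, false)) x) = iter B (step (i, false)) x.
  by move=> xA; rewrite -iterD addnC iterD xA.
by rewrite shift// vE shift.
Qed.

End BallWords.

Section BallGroup.
Variables (d r k : nat).
Local Open Scope group_scope.

Definition ball_type : finType := {w : r.-bseq (letter d) | reduced w}.

Implicit Types (x y : ball_type) (l : letter d) (w : seq (letter d)).

Definition ball_word x : seq (letter d) := val (val x).

Definition ball_pt w (rw : reduced w) (sw : (size w <= r)%N) : ball_type :=
  exist (fun w : r.-bseq (letter d) => reduced w) (Bseq sw) rw.

Lemma ball_reduced x : reduced (ball_word x). Proof. exact: (valP x). Qed.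
Lemma ball_size x : (size (ball_word x) <= r)%N. Proof. exact: size_bseq. Qed.
Lemma ball_word_inj : injective ball_word.
Proof. by move=> x y xy; do 2 apply: val_inj. Qed.

Definition ball_step l x : ball_type :=
  ball_pt (reduced_step r l (ball_reduced x)) (size_step l (ball_size x)).

Lemma ball_word_step l x : ball_word (ball_step l x) = step r l (ball_word x).
Proof. by []. Qed.

Lemma ball_stepK l : cancel (ball_step l) (ball_step (letter_inv l)).
Proof.
move=> x; apply: ball_word_inj; rewrite !ball_word_step stepK//.
  exact: ball_reduced.
exact: ball_size.
Qed.

Definition ball_perm l : {perm ball_type} := perm (can_inj (ball_stepK l)).

Variables (i0 i1 : 'I_d).

(** Three loops at the boundary of the ball carry the letters [a], [b] and [c].
    Shortest paths in the ball do not use loops, and [i0] has a single loop with a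
    nontrivial lamp. *)
Definition volt (i : 'I_d) w : seq gletter :=
  if (i == i0) && (w == nseq r (i1, false)) then [:: La]
  else if (i == i1) && (w == nseq r (i0, false)) then [:: Lb]
  else if (i == i1) && (w == nseq r (i0, true)) then [:: Lc] else [::].

Definition ball_gen (i : 'I_d) : wreath ball_type (tower k) :=
  wmk (ball_perm (i, false)) (fun x => tev k (volt i (ball_word x))).

Definition ball_values : set (wreath ball_type (tower k)) :=
  [set g | exists w, word_eval ball_gen w = g].

Lemma ball_values_subgroup : is_subgroup ball_values.
Proof.
apply/is_subgroupP; split.
- by exists [::]; rewrite word_eval_nil.
- by move=> _ _ [v <-] [w <-]; exists (v ++ w); rewrite word_eval_cat.
- by move=> _ [w <-]; exists (rev (map (@letter_inv d) w)); rewrite word_eval_inv.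
Qed.

Lemma ball_values_letter l : ball_values (letter_eval ball_gen l).
Proof. by exists [:: l]; rewrite word_eval_cons word_eval_nil mulg1. Qed.

Lemma wact_letter l x : wact (letter_eval ball_gen l) x = ball_step l x.
Proof.
have gen_act i y : wact (ball_gen i) y = ball_step (i, false) y by rewrite wact_mk permE.
case: l => i [] /=; rewrite /letter_eval /= ?gen_act//.
by apply: (@wact_inj _ _ (ball_gen i)); rewrite wactKV gen_act -{1}[x](ball_stepK (i, true)).
Qed.

Definition letter_volt l w : seq gletter := volt l.1 (if l.2 then step r l w else w).

Lemma volt_cases i w : volt i w = [::] \/ exists l : gletter, volt i w = [:: l].
Proof.
rewrite /volt; case: ifP => _; first by right; exists La.
case: ifP => _; first by right; exists Lb.
by case: ifP => _; [right; exists Lc|left].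
Qed.

Lemma tev_voltV i w : (tev k (volt i w))^-1 = tev k (volt i w).
Proof.
by case: (volt_cases i w) => [|[l]] ->; rewrite ?tev_cons tev_nil ?mulg1 ?invg1 ?genV.
Qed.

Lemma wlamp_letter l x :
  wlamp (letter_eval ball_gen l) x = tev k (letter_volt l (ball_word x)).
Proof.
case: l => i []; rewrite /letter_eval /letter_volt /=; last by rewrite wlamp_mk.
rewrite wlampV wlamp_mk tev_voltV; congr (tev k (volt i _)).
by have := wact_letter (i, true) x; rewrite /letter_eval /= => ->.
Qed.

Lemma size_volt i w : (size (volt i w) <= 1)%N.
Proof. by case: (volt_cases i w) => [|[l]] ->. Qed.

Lemma wlamp_word w x : exists2 W, (size W <= size w)%N &
  wlamp (word_eval ball_gen w) x = tev k W.
Proof.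
elim: w x => [|l w IHw] x; first by exists [::]; rewrite // word_eval_nil wlamp1 tev_nil.
have [W sW lW] := IHw x; rewrite word_eval_cons wlampM wlamp_letter lW -tev_cat.
exists (letter_volt l (ball_word (wact (word_eval ball_gen w) x)) ++ W) => //.
by rewrite size_cat /= -add1n leq_add// size_volt.
Qed.

Lemma wact_word w x : ball_word (wact (word_eval ball_gen w) x) =
  foldr (step r) (ball_word x) w.
Proof.
elim: w => [|l w IHw]; first by rewrite word_eval_nil wact1.
by rewrite word_eval_cons wactM wact_letter ball_word_step IHw.
Qed.

Definition ball_origin : ball_type := @ball_pt [::] isT (leq0n r).

(** The orbit map at the centre of the ball is injective on words of length at
    most [r]. *)
Lemma ball_faithful w : reduced w -> (size w <= r)%N ->
  word_eval ball_gen w = 1 -> w = [::].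
Proof.
move=> rw sw w1; have := wact_word w ball_origin.
by rewrite w1 wact1 foldr_step.
Qed.

Lemma word_weight_size W : (word_weight W <= 70 * size W)%N.
Proof.
elim: W => [|l W IHW]; first by rewrite /word_weight big_nil.
by rewrite word_weight_cons /=; case: l => /=; lia.
Qed.

Lemma ball_cost : exists C : nat, forall w,
  (10 ^ k * wcost (@tower_cost k) (word_eval ball_gen w) <=
   9 ^ k * (#|ball_type| * 70) * size w + C)%N.
Proof.
have [C costC] := tower_cost_contract k; exists (#|ball_type| * C)%N => w.
rewrite /wcost big_distrr/=.
apply: (@leq_trans (\sum_(x : ball_type) (9 ^ k * (70 * size w) + C))).
  apply: leq_sum => x _; have [W sW ->] := wlamp_word w x.
  apply: leq_trans (costC W) _; rewrite leq_add2r leq_mul2l; apply/orP; right.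
  by apply: leq_trans (word_weight_size W) _; rewrite leq_mul2l.
rewrite sum_nat_const; move: (9 ^ k)%N #|_| => n m; nia.
Qed.

Hypotheses (r_gt0 : (0 < r)%N) (i01 : i0 != i1).

(* Conjugation by such elements transports lamps without changing them. *)
Let connected x y := exists2 g, ball_values g & wact g x = y /\ wlamp g x = 1.

Lemma connected_sym x y : connected x y -> connected y x.
Proof.
move=> [g Tg [gx g1]]; exists g^-1; first exact: (subgroupV ball_values_subgroup).
by rewrite -gx wactK wlampV wactK g1 invg1.
Qed.

Lemma connected_trans x y z : connected x y -> connected y z -> connected x z.
Proof.
move=> [g Tg [gx g1]] [h Th [hy h1]]; exists (h * g).
  exact: (subgroupM ball_values_subgroup).
by rewrite wactM wlampM gx g1 h1 mulg1 hy.
Qed.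

Lemma volt_head i w : volt i w <> [::] -> size w = r /\ avoids i w.
Proof.
have i10 : i1 != i0 by rewrite eq_sym.
have nh (c : letter d) : avoids i (nseq r c) = (c.1 != i).
  by case: (r) r_gt0.
rewrite /volt; case: ifP => [/andP[/eqP iE /eqP ->] _|_].
  by rewrite nh size_nseq iE.
case: ifP => [/andP[/eqP iE /eqP ->] _|_]; first by rewrite nh size_nseq iE.
by case: ifP => [/andP[/eqP iE /eqP ->] _|_] //; rewrite nh size_nseq iE.
Qed.

(** The path from the centre to [x] spelled by the word [x] uses no loop. *)
Lemma connected_origin x : connected ball_origin x.
Proof.
have [w wE] : exists w, ball_word x = w by exists (ball_word x).
elim: w x wE => [|l w IHw] x wE.
  exists 1; first exact: (subgroup1 ball_values_subgroup).
  by rewrite wact1 wlamp1; split => //; exact: ball_word_inj.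
have rlw : reduced (l :: w) by rewrite -wE; exact: ball_reduced.
have slw : (size (l :: w) <= r)%N by rewrite -wE; exact: ball_size.
have rw : reduced w by exact: path_sorted rlw.
have sw : (size w < r)%N by [].
apply: (connected_trans (IHw (ball_pt rw (ltnW sw)) erefl)).
have stepE : step r l w = l :: w.
  rewrite /step; case: (pushP l w) => [[w' [w'E _]]|->]; last by rewrite slw.
  by move: rlw; rewrite w'E /reduced /= eqxx.
exists (letter_eval ball_gen l); first exact: ball_values_letter.
rewrite wact_letter wlamp_letter; split.
  by apply: ball_word_inj; rewrite ball_word_step wE -stepE.
rewrite /letter_volt -[ball_word _]/w stepE.
suff -> : volt l.1 (if l.2 then l :: w else w) = [::] by exact: tev_nil.
apply: contrapT => /volt_head.
by case: l.2 => -[sz]; [rewrite /= eqxx|move: sw; rewrite sz ltnn].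
Qed.

Lemma connectedT x y : connected x y.
Proof. exact: connected_trans (connected_sym (connected_origin x)) (connected_origin y). Qed.

Lemma reduced_nseq n l : reduced (nseq n l).
Proof.
case: n => // n; rewrite /reduced /=; elim: n => //= n ->.
by rewrite eq_sym letter_inv_neq.
Qed.

Lemma size_nseq_le l : (size (nseq r l) <= r)%N. Proof. by rewrite size_nseq. Qed.

Let pt l : ball_type := ball_pt (reduced_nseq r l) (size_nseq_le l).

Lemma step_loop i l : l.1 != i -> step r (i, false) (nseq r l) = nseq r l.
Proof.
move=> li; rewrite /step; case: (pushP (i, false) (nseq r l)) => [[w' [wE _]]|->].
  by case: r r_gt0 wE => // r' _ [lE]; rewrite lE eqxx in li.
rewrite /= size_nseq ltnn; case: (r) => //= r'.
by rewrite (negPf li).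
Qed.

(** A path from a loop to [x] conjugates the loop to a loop at [x]. *)
Lemma lamp_at (x : ball_type) (l : gletter) : exists2 g, ball_values g &
  wact g x = x /\ wlamp g x = gen k l.
Proof.
have i10 : i1 != i0 by rewrite eq_sym.
have nseq_neq c c' : c != c' :> letter d -> (nseq r c == nseq r c') = false.
  by case: r r_gt0 => // r' _; rewrite /= eqseq_cons => /negPf ->.
have loop i c (l' : gletter) : c.1 != i -> volt i (nseq r c) = [:: l'] ->
    exists2 g, ball_values g & wact g x = x /\ wlamp g x = gen k l'.
  move=> ci vE; have [g Tg [gx g1]] := connectedT (pt c) x.
  exists (g * ball_gen i * g^-1).
    apply: (subgroupM ball_values_subgroup); last exact: (subgroupV ball_values_subgroup).
    apply: (subgroupM ball_values_subgroup) => //.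
    exact: (ball_values_letter (i, false)).
  have act_pt : wact (ball_gen i) (pt c) = pt c.
    apply: ball_word_inj; have := wact_letter (i, false) (pt c).
    rewrite /letter_eval /= => ->; rewrite ball_word_step; exact: step_loop.
  have gVx : wact g^-1 x = pt c by rewrite -gx wactK.
  have gV1 : wlamp g^-1 x = 1 by rewrite wlampV gVx g1 invg1.
  rewrite !wactM !wlampM gVx act_pt gx g1 gV1 mul1g mulg1; split => //.
  rewrite [LHS]wlamp_mk.
  have -> : ball_word (pt c) = nseq r c by [].
  by rewrite vE tev_cons tev_nil mulg1.
have [a b c] : [/\ exists2 g, ball_values g & wact g x = x /\ wlamp g x = gen k La,
   exists2 g, ball_values g & wact g x = x /\ wlamp g x = gen k Lb &
   exists2 g, ball_values g & wact g x = x /\ wlamp g x = gen k Lc].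
  split; [apply: (loop i0 (i1, false))|apply: (loop i1 (i0, false))|apply: (loop i1 (i0, true))] => //;
    rewrite /volt ?eqxx ?(negPf i01) ?(negPf i10) ?eqxx //=.
  by rewrite nseq_neq// xpair_eqE eqxx.
case: l => //; case: b c => [g Tg [gx gb]] [h Th [hx hc]].
exists (g * h); first exact: (subgroupM ball_values_subgroup).
by rewrite wactM wlampM hx gx gb hc (gen_relations k).2.
Qed.

(** An odd power of the first generator acts trivially on the ball; as its lamps
    are concentrated at a loop, the power has a single lamp. *)
Lemma single_lamp : ball_values (wat (pt (i1, false)) (gen k La)).
Proof.
have cyc x : exists n, iter n.*2.+1 (ball_step (i0, false)) x == x.
  have [n nE] := step_odd_cycle i0 (ball_reduced x) (ball_size x); exists n.
  apply/eqP/ball_word_inj; rewrite -[in RHS]nE.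
  elim: n.*2.+1 {nE} => // m IHm; by rewrite iterS ball_word_step IHm.
pose n x := xchoose (cyc x).
pose K := (\prod_(x : ball_type) (n x).*2.+1)%N.
have oddK : odd K by rewrite /K; elim/big_ind: _ => [|m m' om om'|x _]; rewrite ?oddM ?om //= odd_double.
have actX m x : wact (ball_gen i0 ^+ m) x = iter m (ball_step (i0, false)) x.
  elim: m => [|m IHm]; first by rewrite expg0 wact1.
  by rewrite expgS wactM IHm; exact: (wact_letter (i0, false)).
have fixK x : iter K (ball_step (i0, false)) x = x.
  rewrite /K (bigD1 x)//= mulnC; move: (\prod_(_ | _) _)%N => m.
  rewrite iterM; elim: m => //= m ->; exact: (eqP (xchooseP (cyc x))).
have lampX m x : wlamp (ball_gen i0 ^+ m) x =
    if x == pt (i1, false) then gen k La ^+ m else 1.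
  have ptfix : ball_step (i0, false) (pt (i1, false)) = pt (i1, false).
    by apply: ball_word_inj; rewrite ball_word_step step_loop// eq_sym.
  elim: m => [|m IHm]; first by rewrite !expg0 wlamp1 if_same.
  rewrite expgS wlampM IHm actX wlamp_mk /volt eqxx (negPf i01) /=.
  have -> : (ball_word (iter m (ball_step (i0, false)) x) == nseq r (i1, false)) =
      (x == pt (i1, false)).
    rewrite -[nseq r _]/(ball_word (pt (i1, false))) (inj_eq ball_word_inj).
    elim: m {IHm} => //= m <-; rewrite -{1}ptfix inj_eq//.
    exact: can_inj (ball_stepK _).
  by case: eqP => _; rewrite ?tev_cons tev_nil ?mulg1 -?expgS.
have -> : wat (pt (i1, false)) (gen k La) = ball_gen i0 ^+ K.
  apply: wreath_ext => x; rewrite ?wact_at ?wlamp_at ?actX ?fixK// lampX.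
  case: ifP => // _; rewrite -[K]odd_double_half oddK addnC -mul2n expgnDr expgnA.
  by rewrite expg2 gen_sq expg1n mul1g.
apply: (subgroupX _ ball_values_subgroup); exact: (ball_values_letter (i0, false)).
Qed.

(** The commutator of [wat x a] with an element fixing [x] and having lamp [b]
    there is [wat x ((a b)^2)], whatever this element does elsewhere. *)
Lemma ball_values_branch x s : branch s -> ball_values (wat x s).
Proof.
have sgT := ball_values_subgroup.
have lampJ g (y : ball_type) t : ball_values g -> ball_values (wat y t) ->
    ball_values (wat (wact g y) (t ^ (wlamp g y)^-1)).
  move=> Tg Ty; rewrite -conj_wat; apply: (subgroupM sgT); last exact: (subgroupV sgT).
  exact: (subgroupM sgT).
have genJ t (l : gletter) : ball_values (wat x t) -> ball_values (wat x (gen k l * t * gen k l)).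
  have [g Tg [gx gl]] := lamp_at x l.
  by move=> /(lampJ g _ _ Tg); rewrite gx gl genV conjgE genV mulgA.
elim=> {s} [|s t _ Ts _ Tt|s l _ Ts]; last exact: genJ.
  have [g Tg [gx g1]] := connectedT (pt (i1, false)) x.
  have Ta : ball_values (wat x (gen k La)).
    by have := lampJ g _ _ Tg single_lamp; rewrite gx g1 invg1 conjg1.
  have := subgroupM sgT Ta (genJ _ Lb Ta); rewrite -watM; congr (ball_values (wat x _)).
  by rewrite !tev_cons tev_nil mulg1 !mulgA.
by rewrite watM; exact: (subgroupM sgT).
Qed.

Lemma ball_values_rigid (R : realType) : amenably_rigid R ball_values.
Proof.
apply: (wreath_rigid (@tower_rigid R k)); first exact: branch_neq1.
by move=> x s; exact: ball_values_branch.
Qed.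

End BallGroup.
(** * Entropy of convolution powers *)

Section TotalSums.
Variable R : realType.
Implicit Types T U : choiceType.
Local Open Scope ereal_scope.

Lemma le_esumT T (f g : T -> \bar R) : (forall x, f x <= g x) ->
  esum setT f <= esum setT g.
Proof. by move=> fg; apply: le_esum => x _. Qed.

Lemma eq_esumT T (f g : T -> \bar R) : f =1 g -> esum setT f = esum setT g.
Proof. by move=> fg; apply: eq_esum => x _. Qed.

Lemma esumT_exchange T U (a : T -> U -> \bar R) : (forall x y, 0 <= a x y) ->
  esum setT (fun x => esum setT (a x)) = esum setT (fun y => esum setT (a^~ y)).
Proof.
move=> a0; rewrite !esum_esum//.
rewrite (@reindex_esum _ _ _ (setT `*`` (fun=> setT)) _ (fun z : T * U => (z.2, z.1)))//.
split=> [[y x] _//|[y x] [y' x'] _ _ /= [-> ->]//|[x y] _].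
by exists (y, x).
Qed.

Lemma esumZl T (S : set T) (r : R) (f : T -> \bar R) : (0 <= r)%R ->
  (forall x, 0 <= f x) -> esum S (fun x => r%:E * f x) = r%:E * esum S f.
Proof.
move=> r0 f0; rewrite /esum -ereal_supZl//; last first.
  apply/set0P; exists (\big[+%E/0]_(x \in set0) f x).
  by exists set0; [exact: fsets_set0|].
congr ereal_sup; have sumE A : finite_set A ->
    \big[+%E/0]_(x \in A) (r%:E * f x) = r%:E * \big[+%E/0]_(x \in A) f x.
  by move=> fA; rewrite !fsbig_finite// ge0_sume_distrr.
apply/seteqP; split => [_ [A [fA sA] <-]|_ [_ [A [fA sA] <-] <-]].
  by exists (\big[+%E/0]_(x \in A) f x); [exists A|rewrite sumE].
by exists A; rewrite ?sumE.
Qed.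

Lemma esumT_delta T (x : T) (f : T -> \bar R) : (forall y, 0 <= f y) ->
  esum setT (fun y => if y == x then f y else 0) = f x.
Proof.
move=> f0; rewrite -[RHS](esum_set1 (f0 x)) [RHS]esum_mkcond; apply: eq_esumT => y.
have [->|yx] := eqVneq y x; first by rewrite mem_set.
by rewrite memNset//= => /eqP; apply/negP.
Qed.

Lemma esumT_fibres T U (phi : T -> U) (a : T -> \bar R) : (forall x, 0 <= a x) ->
  esum setT (fun y => esum (phi @^-1` [set y]) a) = esum setT a.
Proof.
move=> a0; transitivity (esum setT (fun y => esum setT (fun x =>
    if y == phi x then a x else 0))).
  apply: eq_esumT => y; rewrite esum_mkcond; apply: eq_esumT => x.
  have [->|yx] := eqVneq y (phi x); first by rewrite mem_set.
  by rewrite memNset//= => /esym/eqP; apply/negP.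
rewrite esumT_exchange; last by move=> y x; case: ifP.
by apply: eq_esumT => x; rewrite (esumT_delta (phi x) (f := fun=> a x)).
Qed.

Lemma le_esumT_bounded T (f : T -> R) (B : R) : (forall x, 0 <= f x)%R ->
  (forall l : seq T, uniq l -> \sum_(x <- l) f x <= B)%R ->
  esum setT (fun x => (f x)%:E) <= B%:E.
Proof.
move=> f0 fB; apply: ge_ereal_sup => _ [A [fA _] <-].
rewrite fsbig_finite// sumEFin lee_fin; apply: fB; exact: finmap.fset_uniq.
Qed.

End TotalSums.

Section MassFunctions.
Variables (R : realType) (G : groupType).
Implicit Types p q r : G -> R.
Local Open Scope ereal_scope.

Definition mass_function p : Prop :=
  (forall g, 0 <= p g)%R /\ esum setT (fun g => (p g)%:E) = 1.

Lemma mass_ge0 p g : mass_function p -> (0 <= p g)%R.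
Proof. by case. Qed.

Lemma mass_le1 p g : mass_function p -> (p g <= 1)%R.
Proof.
move=> [p0 p1]; rewrite -lee_fin -p1; apply: esum_ge; exists [set g].
  by split => //; exact: finite_set1.
by rewrite fsbig_set1.
Qed.

Lemma esumT_translate (h : G) (f : G -> \bar R) :
  esum setT (fun g => f (h^-1 * g)%g) = esum setT f.
Proof.
apply/esym; rewrite (@reindex_esum _ _ _ setT setT (fun g => (h^-1 * g)%g) f)//.
split=> [//|x y _ _ /mulgI//|y _]; exists (h * y)%g => //; exact: mulKg.
Qed.

Lemma convolutionE p q g : mass_function p -> mass_function q ->
  (convolution p q g)%:E = esum setT (fun h => (p h)%:E * (q (h^-1 * g)%g)%:E).
Proof.
move=> mp mq; rewrite /convolution fineK.
  by apply: eq_esumT => h; rewrite EFinM.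
rewrite ge0_fin_numE; last first.
  by apply: esum_ge0 => h _; rewrite lee_fin mulr_ge0// mass_ge0.
apply: (@le_lt_trans _ _ 1); last exact: ltry.
rewrite -mp.2; apply: le_esumT => h; rewrite lee_fin ler_piMr ?mass_ge0//.
exact: mass_le1.
Qed.

(** The total mass, the moments and the associativity of convolutions all follow
    from this exchange of sums. *)
Lemma convolution_sum p q (f : G -> R) : mass_function p -> mass_function q ->
  (forall g, 0 <= f g)%R ->
  esum setT (fun g => (convolution p q g * f g)%:E) =
  esum setT (fun h => (p h)%:E * esum setT (fun k => (q k * f (h * k)%g)%:E)).
Proof.
move=> mp mq f0; have p0 := mp.1; have q0 := mq.1.
have pq0 g h : 0 <= (p h)%:E * (q (h^-1 * g)%g)%:E.
  by rewrite mule_ge0// lee_fin.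
transitivity (esum setT (fun g => esum setT (fun h =>
    (p h * (q (h^-1 * g)%g * f g))%:E))).
  apply: eq_esumT => g; rewrite mulrC EFinM convolutionE// -esumZl//.
  by apply: eq_esumT => h; rewrite -!EFinM mulrC mulrA.
rewrite esumT_exchange; last by move=> g h; rewrite lee_fin !mulr_ge0.
apply: eq_esumT => h; rewrite -esumZl//; last by move=> k; rewrite lee_fin mulr_ge0.
rewrite -[RHS](esumT_translate h); apply: eq_esumT => g.
by rewrite mulVKg EFinM.
Qed.

Lemma convolution_ge0 p q g : mass_function p -> mass_function q ->
  (0 <= convolution p q g)%R.
Proof.
move=> mp mq; rewrite -lee_fin convolutionE//; apply: esum_ge0 => h _.
by rewrite mule_ge0// lee_fin mass_ge0.
Qed.

Lemma mass_convolution p q : mass_function p -> mass_function q ->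
  mass_function (convolution p q).
Proof.
move=> mp mq; split=> [g|]; first exact: convolution_ge0.
have := convolution_sum mp mq (f := fun=> 1%R) (fun=> ler01).
under eq_esum do rewrite mulr1; move=> ->; rewrite -mp.2; apply: eq_esumT => h.
under eq_esum do rewrite mulr1; by rewrite mq.2 mule1.
Qed.

Definition delta1 : G -> R := fun g => ((g == 1%g)%:R)%R.

Lemma mass_delta1 : mass_function delta1.
Proof.
split=> [g|]; first exact: ler0n.
rewrite -(esumT_delta (1%g : G) (f := fun=> 1)) //; apply: eq_esumT => g.
by rewrite /delta1; case: eqP.
Qed.

Lemma convolution1 p : mass_function p -> convolution delta1 p = p.
Proof.
move=> mp; apply: funext => g; apply: EFin_inj; rewrite convolutionE//; last exact: mass_delta1.
rewrite -[RHS](esumT_delta (1%g : G) (f := fun=> (p g)%:E)); last first.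
  by move=> _; rewrite lee_fin mass_ge0.
apply: eq_esumT => h; rewrite /delta1; case: eqP => [->|_]; last by rewrite mul0e.
by rewrite invg1 mul1g mul1e.
Qed.

Lemma convolutionA p q r : mass_function p -> mass_function q -> mass_function r ->
  convolution p (convolution q r) = convolution (convolution p q) r.
Proof.
move=> mp mq mr; apply: funext => g; apply: EFin_inj.
rewrite [RHS]convolutionE//; last exact: mass_convolution.
under [RHS]eq_esum do rewrite -EFinM.
rewrite (convolution_sum mp mq (f := fun k => r (k^-1 * g)%g)); last by move=> k; exact: mass_ge0.
rewrite convolutionE//; last exact: mass_convolution.
apply: eq_esumT => h; rewrite convolutionE//; congr (_ * _); apply: eq_esumT => k.
by rewrite EFinM invgM mulgA.
Qed.

Lemma mass_power p m : mass_function p -> mass_function (convolution_power p m).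
Proof.
by move=> mp; elim: m => [|m IHm]; [exact: mass_delta1|exact: mass_convolution].
Qed.

Lemma convolution_powerD p m n : mass_function p ->
  convolution_power p (m + n) = convolution (convolution_power p m) (convolution_power p n).
Proof.
move=> mp; elim: m => [|m IHm]; first by rewrite add0n convolution1//; exact: mass_power.
rewrite addSn -[LHS]/(convolution p (convolution_power p (m + n))) IHm.
by rewrite convolutionA//; exact: mass_power.
Qed.

Definition moment (len : G -> nat) p : \bar R :=
  esum setT (fun g => (p g * (len g)%:R)%:E).

Lemma momentM (len : G -> nat) p q : mass_function p -> mass_function q ->
  (forall g h, (len (g * h)%g <= len g + len h)%N) ->
  moment len (convolution p q) <= moment len p + moment len q.
Proof.
move=> mp mq lenM; rewrite /moment convolution_sum//.
apply: (@le_trans _ _ (esum setT (fun h => (p h * (len h)%:R)%:E +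
    (p h)%:E * moment len q))).
  apply: le_esumT => h.
  rewrite EFinM -ge0_muleDr//; last first.
    by apply: esum_ge0 => g _; rewrite lee_fin mulr_ge0// mass_ge0.
  rewrite lee_wpmul2l//; first by rewrite lee_fin mass_ge0.
  rewrite -{1}[(len h)%:R%:E]mule1 -mq.2 -esumZl//; last first.
    by move=> g; rewrite lee_fin mass_ge0.
  rewrite /moment -esumD; last 2 first.
  - by move=> g _; rewrite lee_fin mulr_ge0// mass_ge0.
  - by move=> g _; rewrite lee_fin mulr_ge0// mass_ge0.
  apply: le_esumT => g; rewrite -EFinM -EFinD lee_fin [((len h)%:R * _)%R]mulrC -mulrDr.
  by rewrite ler_wpM2l ?mass_ge0// -natrD ler_nat.
rewrite esumD; last 2 first.
- by move=> g _; rewrite lee_fin mulr_ge0// mass_ge0.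
- move=> g _; rewrite mule_ge0// ?lee_fin ?mass_ge0//.
  by apply: esum_ge0 => h _; rewrite lee_fin mulr_ge0// mass_ge0.
rewrite leeD2l//.
have [qoo|qfin] := eqVneq (moment len q) +oo; first by rewrite -/(moment len q) qoo leey.
have m0 : 0 <= moment len q.
  by apply: esum_ge0 => h _; rewrite lee_fin mulr_ge0// mass_ge0.
have fq : moment len q \is a fin_num by rewrite ge0_fin_numE// ltey.
rewrite -(fineK fq); under eq_esum do rewrite muleC.
rewrite esumZl//; first by rewrite mp.2 mule1 fineK.
- by rewrite fine_ge0.
- by move=> g; rewrite lee_fin mass_ge0.
Qed.

(** ** Shannon entropy *)

Lemma eta_ge0 (x : R) : (0 <= x)%R -> (x <= 1)%R -> (0 <= - (x * ln x))%R.
Proof. by move=> x0 x1; rewrite oppr_ge0 mulr_ge0_le0// ln_le0. Qed.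

Lemma shannon_ge0 p : mass_function p -> 0 <= shannon_entropy p.
Proof.
by move=> mp; apply: esum_ge0 => g _; rewrite lee_fin eta_ge0 ?mass_ge0 ?mass_le1.
Qed.

Lemma etaM (x y : R) : (0 <= x)%R -> (0 <= y)%R ->
  (- (x * y * ln (x * y)) = x * - (y * ln y) + y * - (x * ln x))%R.
Proof.
rewrite !le_eqVlt => /predU1P[<-|x0] /predU1P[<-|y0]; rewrite ?(mul0r, mulr0, oppr0, addr0)//.
by rewrite lnM ?posrE//; ring.
Qed.

(** The entropy of a convolution is at most that of the independent pair: the
    function [x |-> - x ln x] is subadditive over countable sums. *)
Lemma shannonM p q : mass_function p -> mass_function q ->
  shannon_entropy (convolution p q) <= shannon_entropy p + shannon_entropy q.
Proof.
move=> mp mq; have p0 := mp.1; have q0 := mq.1.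
have p1 g := mass_le1 g mp; have q1 g := mass_le1 g mq.
have mpq := mass_convolution mp mq.
pose x g h : R := (p h * q (h^-1 * g)%g)%R.
have x0 g h : (0 <= x g h)%R by rewrite mulr_ge0.
have xle g h : (x g h <= convolution p q g)%R.
  rewrite -lee_fin convolutionE//; apply: esum_ge; exists [set h].
    by split => //; exact: finite_set1.
  by rewrite fsbig_set1 -EFinM.
have x1 g h : (x g h <= 1)%R by apply: le_trans (xle g h) (mass_le1 g mpq).
apply: (@le_trans _ _ (esum setT (fun g => esum setT (fun h =>
    (- (x g h * ln (x g h)))%:E)))).
  apply: le_esumT => g; rewrite mulrC -mulNr EFinM convolutionE//.
  rewrite -esumZl//; last 2 first.
  - by rewrite oppr_ge0 ln_le0// mass_le1.
  - by move=> h; rewrite mule_ge0// lee_fin.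
  apply: le_esumT => h; rewrite -!EFinM lee_fin mulNr lerN2 -/(x g h) mulrC.
  have [->|xn0] := eqVneq (x g h) 0%R; first by rewrite !mulr0.
  have xgt : (0 < x g h)%R by rewrite lt0r xn0 x0.
  rewrite ler_wpM2r// ler_ln ?posrE//; exact: lt_le_trans (xle g h).
rewrite esumT_exchange; last by move=> g h; rewrite lee_fin eta_ge0.
apply: (@le_trans _ _ (esum setT (fun h => (- (p h * ln (p h)))%:E +
    (p h)%:E * shannon_entropy q))).
  apply: le_esumT => h; rewrite /shannon_entropy -esumZl//; last first.
    by move=> g; rewrite lee_fin eta_ge0.
  rewrite -[X in X%:E + _]mulr1 EFinM -mq.2 -esumZl; [|exact: eta_ge0|by move=> g; rewrite lee_fin].
  rewrite -(esumT_translate h (fun g => (- (p h * ln (p h)))%:E * (q g)%:E)).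
  rewrite -(esumT_translate h (fun g => (p h)%:E * (- (q g * ln (q g)))%:E)).
  rewrite -esumD; last 2 first.
  - by move=> g _; rewrite -EFinM lee_fin mulr_ge0// eta_ge0.
  - by move=> g _; rewrite -EFinM lee_fin mulr_ge0// eta_ge0.
  by apply: le_esumT => g; rewrite -!EFinM -EFinD lee_fin etaM// addrC [(q _ * _)%R]mulrC.
have H0 := shannon_ge0 mq.
rewrite esumD; last 2 first.
- by move=> g _; rewrite lee_fin eta_ge0.
- by move=> g _; rewrite mule_ge0// lee_fin.
rewrite leeD2l//.
have [qoo|qfin] := eqVneq (shannon_entropy q) +oo; first by rewrite qoo leey.
have fq : shannon_entropy q \is a fin_num by rewrite ge0_fin_numE// ltey.
rewrite -(fineK fq); under eq_esum do rewrite muleC.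
rewrite esumZl//; first by rewrite mp.2 mule1.
by rewrite fine_ge0.
Qed.

(** Gibbs' inequality: [- x ln x <= x phi + exp (- phi)]. *)
Lemma shannon_le p (phi : G -> R) : mass_function p -> (forall g, 0 <= phi g)%R ->
  shannon_entropy p <= esum setT (fun g => (p g * phi g)%:E) +
                       esum setT (fun g => (expR (- phi g))%:E).
Proof.
move=> mp phi0; rewrite -esumD; last 2 first.
- by move=> g _; rewrite lee_fin mulr_ge0// mass_ge0.
- by move=> g _; rewrite lee_fin expR_ge0.
apply: le_esumT => g; rewrite -EFinD lee_fin.
have := mass_ge0 g mp; rewrite le_eqVlt => /predU1P[<-|pg].
  by rewrite !mul0r oppr0 add0r expR_ge0.
have := expR_ge1Dx (- phi g - ln (p g)); rewrite expRD [expR (- ln _)]expRN lnK ?posrE//.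
rewrite ler_pdivlMr//; lra.
Qed.

End MassFunctions.

Section Fekete.
Variable R : realType.
Local Open Scope ring_scope.

(** Fekete's lemma, for sequences of at most linear growth: the limit is the infimum
    of [u n / n], which is at most [K]. *)
Lemma fekete (u : nat -> R) (K D : R) : (forall n, 0 <= u n) ->
  (forall m n, u (m + n)%N <= u m + u n) -> (forall n, u n <= K * n%:R + D) ->
  exists l, [/\ 0 <= l, l <= K & n%:R^-1 * u n @[n --> \oo] --> l].
Proof.
move=> u0 uD uK; pose E := [set n.+1%:R^-1 * u n.+1 | n in [set: nat]].
have E0 : E !=set0 by exists (1%:R^-1 * u 1%N); exists 0%N.
have lb0 : lbound E 0 by move=> _ [n _ <-]; rewrite mulr_ge0// invr_ge0.
have lbE : has_inf E by split => //; exists 0.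
exists (inf E); split; first exact: lb_le_inf.
  rewrite leNgt; apply/negP => KE; rewrite -subr_gt0 in KE.
  pose n := Num.truncn ((inf E - K)^-1 * D).
  have nD : (inf E - K)^-1 * D < n.+1%:R by exact: truncnS_gt.
  have n0 : 0 < n.+1%:R :> R by rewrite ltr0n.
  have : inf E <= n.+1%:R^-1 * u n.+1 by apply: (ge_inf lbE.2); exists n.
  rewrite mulrC ler_pdivlMr// => En.
  by move: nD; rewrite mulrC ltr_pdivrMr//; have := uK n.+1; nra.
apply/cvgrPdist_le => e e0.
(* Divide [m] by [n + 1], where [u (n + 1) / (n + 1)] is close to the infimum. *)
have [_ [n _ <-] un] : exists2 x, E x & x < inf E + e / 2.
  by apply: inf_adherent; rewrite ?divr_gt0.
have multiple q : u (q * n.+1)%N <= q%:R * u n.+1 + u 0%N.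
  elim: q => [|q IHq]; first by rewrite mul0r add0r.
  by rewrite mulSn mulrSr mulrDl mul1r; apply: le_trans (uD _ _) _; lra.
pose B := \sum_(j < n.+1) u j + u 0%N.
have B0 : 0 <= B by rewrite addr_ge0// sumr_ge0.
near=> m.
have m0 : (0 < m)%N by near: m; exists 1%N.
have mR : 0 < m%:R :> R by rewrite ltr0n.
have mB : m%:R^-1 * B <= e / 2.
  rewrite mulrC ler_pdivrMr// -ler_pdivrMl ?divr_gt0//.
  near: m; exists (Num.truncn ((e / 2)^-1 * B)).+1 => // m /= Bm.
  by apply/ltW/(lt_le_trans (truncnS_gt _)); rewrite ler_nat.
have infm : inf E <= m%:R^-1 * u m.
  by apply: (ge_inf lbE.2); exists m.-1 => //; rewrite prednK.
rewrite ler0_norm ?subr_le0// opprB lerBlDr.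
rewrite [X in _ * u X](divn_eq m n.+1) (addrC e).
have um : u (m %/ n.+1 * n.+1 + m %% n.+1)%N <= (m %/ n.+1)%:R * u n.+1 + B.
  have lastu : u (m %% n.+1)%N <= \sum_(j < n.+1) u j.
    by rewrite (bigD1 (Ordinal (ltn_pmod m (ltn0Sn n))))//= lerDl sumr_ge0.
  have := uD (m %/ n.+1 * n.+1)%N (m %% n.+1)%N.
  by have := multiple (m %/ n.+1)%N; have := u0 0%N; rewrite /B; lra.
have qn : m%:R^-1 * ((m %/ n.+1)%:R * u n.+1) <= n.+1%:R^-1 * u n.+1.
  rewrite mulrA ler_wpM2r// mulrC ler_pdivrMr// mulrC ler_pdivlMr//.
  by rewrite -natrM ler_nat leq_trunc_div.
have : m%:R^-1 * u (m %/ n.+1 * n.+1 + m %% n.+1)%N <=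
    m%:R^-1 * ((m %/ n.+1)%:R * u n.+1 + B).
  by rewrite ler_wpM2l// invr_ge0.
move=> h; apply: le_trans h _; rewrite mulrDr; apply: le_trans (lerD qn mB) _.
by rewrite {2}[e]splitr addrA lerD2r; exact: ltW.
Unshelve. all: by end_near. Qed.

End Fekete.

Section EntropyRate.
Variables (R : realType) (G : groupType) (len cost : G -> nat) (q eps C : R).
Local Open Scope ereal_scope.
Hypotheses (len1 : len 1%g = 0%N)
  (lenM : forall g h, (len (g * h)%g <= len g + len h)%N)
  (q_gt0 : (0 < q)%R) (q_lt1 : (q < 1)%R) (cost_sum : summable_cost q cost)
  (eps_ge0 : (0 <= eps)%R) (C_ge0 : (0 <= C)%R)
  (cost_len : forall g, ((cost g)%:R <= eps * (len g)%:R + C)%R).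

Lemma moment_power (p : G -> R) m : mass_function p ->
  moment len (convolution_power p m) <= m%:R%:E * moment len p.
Proof.
move=> mp; have mom0 : 0 <= moment len p.
  by apply: esum_ge0 => g _; rewrite lee_fin mulr_ge0// mass_ge0.
elim: m => [|m IHm].
  rewrite mul0e /moment esum1// => g _.
  by rewrite /convolution_power /=; case: eqP => [->|_]; rewrite ?len1 ?mulr0 ?mul0r.
apply: le_trans (momentM mp (mass_power m mp) lenM) _.
apply: le_trans (leeD2l _ IHm) _.
by rewrite -add1n natrD EFinD ge0_muleDl ?mul1e// lee_fin.
Qed.

(** The entropy is controlled by the expected length, since the elements of small
    length have small cost and there are few elements of small cost. *)
Lemma entropy_rate_small (p : G -> R) (L : R) : mass_function p ->
  moment len p <= L%:E ->
  exists l : R, [/\ (0 <= l)%R, (l <= - ln q * eps * L)%R &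
    entropy_rate p n @[n --> \oo] --> l%:E].
Proof.
move=> mp pL; have [B costB] := cost_sum.
have lnq : (0 <= - ln q)%R by rewrite oppr_ge0 ln_le0// ltW.
have bound m : shannon_entropy (convolution_power p m) <=
    (- ln q * eps * L * m%:R + (- ln q * C + B))%:E.
  have mpm := mass_power m mp; have pm0 g := mass_ge0 g mpm.
  have phi0 g : (0 <= - ln q * (cost g)%:R)%R by rewrite mulr_ge0.
  apply: le_trans (shannon_le mpm phi0) _.
  rewrite addrA EFinD leeD//; last first.
    have -> : (fun g => (expR (- (- ln q * (cost g)%:R)))%:E) = (fun g => (q ^+ cost g)%:E).
      apply: funext => g; congr EFin.
      by rewrite mulNr opprK mulrC expRM_natl lnK// posrE.
    by apply: le_esumT_bounded => // g; exact/exprn_ge0/ltW.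
  apply: (@le_trans _ _ (esum setT (fun g =>
      (- ln q * eps)%:E * (convolution_power p m g * (len g)%:R)%:E +
      (- ln q * C)%:E * (convolution_power p m g)%:E))).
    apply: le_esumT => g; rewrite -!EFinM -EFinD lee_fin.
    have := cost_len g; move: (convolution_power p m g) (pm0 g) => x x0 cg.
    apply: (@le_trans _ _ (x * (- ln q * (eps * (len g)%:R + C)))%R).
      by rewrite ler_wpM2l// ler_wpM2l.
    by rewrite le_eqVlt; apply/orP; left; apply/eqP; ring.
  rewrite esumD; last 2 first.
  - by move=> g _; rewrite -!EFinM lee_fin !mulr_ge0.
  - by move=> g _; rewrite -!EFinM lee_fin !mulr_ge0.
  rewrite !esumZl ?mulr_ge0//; last first.
    by move=> g; rewrite lee_fin mulr_ge0.
  have -> : (- ln q * eps * L * m%:R = (- ln q * eps) * (L * m%:R))%R by rewrite !mulrA.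
  rewrite mpm.2 mule1 EFinD leeD2r// [leRHS]EFinM.
  apply: lee_wpmul2l; first by rewrite lee_fin mulr_ge0.
  apply: le_trans (moment_power m mp) _.
  by rewrite mulrC EFinM lee_wpmul2l// lee_fin.
pose u m := fine (shannon_entropy (convolution_power p m)).
have H0 m : 0 <= shannon_entropy (convolution_power p m).
  exact/shannon_ge0/mass_power.
have uE m : shannon_entropy (convolution_power p m) = (u m)%:E.
  by rewrite fineK// ge0_fin_numE// (le_lt_trans (bound m))// ltry.
have [|m n|n|l [l0 lK ul]] := @fekete R u (- ln q * eps * L) (- ln q * C + B).
- by move=> n; rewrite -lee_fin -uE.
- rewrite -lee_fin EFinD -!uE convolution_powerD//.
  by apply: shannonM; exact: mass_power.
- by rewrite -lee_fin -uE.
exists l; split => //.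
have -> : entropy_rate p = (fun n => (n%:R^-1 * u n)%:E).
  by apply: funext => n; rewrite /entropy_rate uE EFinM.
exact: (cvg_comp _ _ ul).
Qed.

End EntropyRate.

Section MarkedMass.
Variables (R : realType) (d : nat) (mu : probability (free_group d) R).
Variable M : marked_group d.
Local Open Scope ereal_scope.

(** The free group is countable: it is enumerated by [pickle]. *)
Lemma probability_esum (A : set (free_group d)) :
  mu A = esum A (fun x => mu [set x]).
Proof.
pose An n := A `&` pickle @^-1` [set n].
have AE : A = \bigcup_n An n.
  by apply/seteqP; split => [x Ax|x [n _ []]//]; exists (pickle x).
have Anmu n : mu (An n) = esum (An n) (fun x => mu [set x]).
  have [[x Ax]|A0] := pselect (exists x, An n x).
    have -> : An n = [set x].
      apply/seteqP; split => [y Ay|y ->//]; apply: (pcan_inj (@pickleK _)).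
      by rewrite Ax.2 Ay.2.
    by rewrite esum_set1.
  have -> : An n = set0 by apply/seteqP; split => // x Ax; apply: A0; exists x.
  by rewrite measure0 esum_set0.
rewrite {1}AE measure_semi_bigcup//; last first.
  apply/trivIsetP => i j _ _ ij; apply/seteqP; split => // x [[_ xi] [_ xj]].
  by move: ij; rewrite -xi -xj eqxx.
rewrite (eq_eseriesr (fun i _ => Anmu i)).
rewrite nneseries_esumT//; last by move=> n; exact: esum_ge0.
rewrite [RHS]esum_mkcond -[RHS](esumT_fibres (@pickle (free_group d)))//; last first.
  by move=> x; case: ifP.
by apply: eq_esumT => n; rewrite -esum_mkcondr setIC.
Qed.

Lemma marked_massE (g : M) :
  (marked_mass mu g)%:E = esum (@marking d M @^-1` [set g]) (fun x => mu [set x]).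
Proof. by rewrite -probability_esum /marked_mass fineK// fin_num_measure. Qed.

Lemma marked_mass_function : mass_function (@marked_mass R d mu M).
Proof.
split=> [g|]; first by rewrite fine_ge0.
under eq_esum do rewrite marked_massE.
by rewrite esumT_fibres// -probability_esum probability_setT.
Qed.

Lemma word_length1 : word_length (1%g : M) = 0%N.
Proof.
apply/eqP; rewrite -leqn0; apply/(ballP 0 (1%g : M)).
by exists [::] => //; exact: word_eval_nil.
Qed.

Lemma word_lengthM (g h : M) : (word_length (g * h)%g <= word_length g + word_length h)%N.
Proof.
have [v vs vg] := (ballP _ g).1 (leqnn (word_length g)).
have [w ws wh] := (ballP _ h).1 (leqnn (word_length h)).
apply/(ballP (word_length g + word_length h) (g * h)%g).
by exists (v ++ w); rewrite ?word_eval_cat ?vg ?wh// size_cat leq_add.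
Qed.

Lemma word_length_marking (x : free_marked_group d) :
  (word_length (marking M x) <= word_length x)%N.
Proof.
have [w ws xE] := (ballP _ x).1 (leqnn (word_length x)).
apply/(ballP (word_length x) (marking M x)).
by exists w => //; rewrite -marking_eval -xE.
Qed.

Lemma marked_moment : moment (@word_length d M) (@marked_mass R d mu M) <=
  esum setT (fun x : free_group d =>
    (word_length (x : free_marked_group d))%:R%:E * mu [set x]).
Proof.
have mul0 x : 0 <= (word_length (x : free_marked_group d))%:R%:E * mu [set x].
  by rewrite mule_ge0// lee_fin.
rewrite -(esumT_fibres (marking M))//; apply: le_esumT => g.
rewrite mulrC EFinM marked_massE -esumZl//; apply: le_esum => x /= <-.
by rewrite lee_wpmul2r// lee_fin ler_nat word_length_marking.
Qed.

End MarkedMass.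
(** * The marked groups *)

Section ImageGroup.
Variables (W : groupType) (d : nat) (s : 'I_d -> W).
Local Open Scope group_scope.

Definition image_pred : pred W := fun g => `[< exists w, word_eval s w = g >].

Fact image_closed : group_closed image_pred.
Proof.
split; first by apply/asboolP; exists [::]; exact: word_eval_nil.
move=> _ _ /asboolP[v <-] /asboolP[w <-]; apply/asboolP.
by exists (v ++ rev (map (@letter_inv d) w)); rewrite word_eval_cat word_eval_inv.
Qed.

Record image_group := ImageGroup { image_val :> W; image_valP : image_pred image_val }.

HB.instance Definition _ := [isSub for image_val].
HB.instance Definition _ := [Choice of image_group by <:].
HB.instance Definition _ :=
  SubChoice_isSubGroup.Build W image_pred image_group image_closed.

Lemma image_gen_subproof i : image_pred (s i).
Proof.
by apply/asboolP; exists [:: (i, false)]; rewrite word_eval_cons word_eval_nil mulg1.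
Qed.

Definition image_gen i : image_group := ImageGroup (image_gen_subproof i).

Lemma image_valM (g h : image_group) : image_val (g * h) = image_val g * image_val h.
Proof. exact: valM. Qed.

Lemma image_val1 : image_val 1 = 1. Proof. exact: val1. Qed.

Lemma image_valV (g : image_group) : image_val g^-1 = (image_val g)^-1.
Proof. by apply/esym/mulg1_eq; rewrite -image_valM mulgV image_val1. Qed.

Lemma image_valJ (g h : image_group) : image_val (g ^ h) = image_val g ^ image_val h.
Proof. by rewrite !conjgE !image_valM image_valV. Qed.

Lemma image_val_word w : image_val (word_eval image_gen w) = word_eval s w.
Proof.
elim: w => [|l w IHw]; first by rewrite !word_eval_nil image_val1.
rewrite !word_eval_cons image_valM IHw; congr (_ * _).
by case: l => i [] //=; rewrite /letter_eval /= image_valV.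
Qed.

Fact image_generates : generates image_gen.
Proof.
apply/generatesP => g; have /asboolP[w wE] := image_valP g.
by exists w; apply: val_inj; exact: etrans (image_val_word w) wE.
Qed.

Definition image_marked : marked_group d := MarkedGroup image_generates.

Lemma image_val_morph (H : set image_group) : morph_on H image_val.
Proof. by move=> g h _ _; exact: image_valM. Qed.

Lemma image_normal_trivial (R : realType) (N : set image_group) :
  amenably_rigid R [set g | exists w, word_eval s w = g] ->
  is_subgroup N -> is_normal N -> amenable R N -> N = [set 1].
Proof.
move=> rs sgN nN aN; apply/seteqP; split => [n Nn|_ ->]; last exact: subgroup1.
apply: val_inj; rewrite [RHS]image_val1.
apply: (rs (image_val @` N)); last by exists n.
- exact: subgroup_image sgN (@image_val_morph N).
- exact: amenable_image sgN (@image_val_morph N) aN.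
move=> _ _ [w <-] [m Nm <-]; rewrite -image_val_word -image_valV -!image_valJ.
by split; [exists (m ^ word_eval image_gen w)|exists (m ^ (word_eval image_gen w)^-1)];
  rewrite //; exact: nN.
Qed.

Lemma image_amenable_fg (R : realType) : amenable_fg R W -> amenable_fg R image_group.
Proof.
move=> fgW H sgH aH.
have sgI := subgroup_image sgH (@image_val_morph H).
have [l' lE] := fgW _ sgI (amenable_image sgH (@image_val_morph H) aH).
have [l [l'E lH]] : exists l, l' = map image_val l /\ forall x, x \in l -> H x.
  have : forall y, y \in l' -> (image_val @` H) y.
    by move=> y yl'; rewrite lE; exact: mem_generated.
  elim: l' {lE} => [|y l' IHl'] lH; first by exists [::].
  have [l [-> lH']] := IHl' (fun z zl => lH z (mem_behead (s := y :: l') zl)).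
  have [x Hx <-] := lH y (mem_head _ _); exists (x :: l); split => //.
  by move=> z; rewrite inE => /predU1P[->//|/lH'].
exists l; apply/seteqP; split; last exact: generated_min.
move=> h Hh; have sgl := generated_subgroup l.
have : generated l' (image_val h) by rewrite -lE; exists h.
have : generated l' `<=` image_val @` generated l.
  apply: generated_min; first exact: subgroup_image sgl (@image_val_morph _).
  by move=> y; rewrite l'E => /mapP[x xl ->]; exists x => //; exact: mem_generated.
by move=> sub /sub[h' lh' /val_inj <-].
Qed.

End ImageGroup.

(** The amenable subgroups are named by finite lists of words in the generators. *)
Lemma countable_amenable_subgroups (R : realType) d (M : marked_group d) :
  amenable_fg R M -> countable [set H : set M | is_subgroup H /\ amenable R H].
Proof.
move=> fgM; pose f (l : seq (free_group d)) : set M := generated (map (marking M) l).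
apply: (@sub_countable _ _ _ (range f)); last first.
  exact: (card_le_trans (card_image_le _ _) (countableP _)).
apply: subset_card_le => H [sgH /(fgM H sgH)[l ->]].
have [l' ->] : exists l', l = map (marking M) l'.
  elim: l => [|x l [l' ->]]; first by exists [::].
  have : range (marking M) x by rewrite marking_surj.
  by move=> [y _ <-]; exists (y :: l').
by exists l'.
Qed.

(** Two elements of the ball, or an edge between two of them, are compared by a word
    of length at most [2 r + 1]. *)
Lemma free_ball_iso d r (M : marked_group d) :
  (forall x : free_group d, (size (fg_word x) <= r.*2.+1)%N ->
    marking M x = 1%g -> x = 1%g) ->
  ball_iso r (free_marked_group d) M.
Proof.
move=> girth.
have size_ball x : @Defs.ball d (free_marked_group d) r x ->
    (size (fg_word (x : free_group d)) <= r)%N.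
  move=> /ballP[w wr <-]; apply: leq_trans wr.
  rewrite -[word_eval _ w]/(word_eval (@fg_gen d) w) fg_word_eval_act.
  elim: w => //= l w IHw; case: (foldr _ _ _) IHw => [|l' u] //= IHw.
  by case: ifP => _ //=; lia.
have mV (x : free_group d) : marking M x^-1%g = (marking M x)^-1%g.
  by apply/esym/mulg1_eq; rewrite -markingM mulgV marking1.
have sizeV (x : free_group d) : size (fg_word x^-1%g) = size (fg_word x).
  by rewrite fg_wordV size_word_inv.
have eqP x y :
    (size (fg_word (x : free_group d)) + size (fg_word (y : free_group d)) <= r.*2.+1)%N ->
    marking M x = marking M y -> x = y.
  move=> sxy xy; rewrite -[y](mulVKg x); suff -> : (x^-1 * y)%g = 1%g by rewrite mulg1.
  apply: girth; last by rewrite markingM mV xy mulVg.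
  by apply: leq_trans (size_fgM _ _) _; rewrite sizeV.
exists (marking M); split; first exact: marking1.
  split.
  - move=> x /ballP[w wr wx]; apply/ballP; exists w => //.
    by rewrite -marking_eval; congr marking.
  - move=> x y /set_mem/size_ball sx /set_mem/size_ball sy; apply: eqP; lia.
  - move=> _ /ballP[w wr <-]; exists (word_eval (@fg_gen d) w); last exact: marking_eval.
    by apply/(@ballP d (free_marked_group d)); exists w.
move=> i x y /size_ball sx /size_ball sy; split=> [->|yx].
  by rewrite -[mg_gen _ _]/(fg_gen i) markingM marking_gen.
apply: eqP; last by rewrite yx -marking_gen -markingM.
have := size_fgM (x : free_group d) (fg_gen i); rewrite [size (fg_word (fg_gen i))]/=.
by rewrite -[(x * mg_gen _ _)%g]/((x : free_group d) * fg_gen i)%g; lia.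
Qed.

Section BallMarked.
Variables (R : realType) (d r k : nat) (i0 i1 : 'I_d).
Definition ball_marked : marked_group d := image_marked (@ball_gen d r k i0 i1).

Definition ball_rate : R := ((9 / 10) ^+ k * (#|ball_type d r| * 70)%:R)%R.

(** On an element of length [n], the cost is at most [ball_rate * n] up to an
    additive constant. *)
Lemma ball_marked_entropy (mu : probability (free_group d) R) (L : R) :
  (esum setT (fun x : free_group d =>
    (word_length (x : free_marked_group d))%:R%:E * mu [set x]) <= L%:E)%E ->
  exists l : R, [/\ (0 <= l)%R, (l <= - ln (12%:R^-1) * ball_rate * L)%R &
    entropy_rate (@marked_mass R d mu ball_marked) n @[n --> \oo] --> l%:E].
Proof.
move=> muL; have [C costC] := @ball_cost d r k i0 i1.
pose cost (g : ball_marked) := wcost (@tower_cost k) (image_val g).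
apply: (@entropy_rate_small R ball_marked (@word_length d ball_marked) cost _ _ C%:R%R).
- exact: word_length1.
- exact: word_lengthM.
- by rewrite invr_gt0.
- by rewrite invf_lt1// ltr1n.
- have [|B costB] := @wreath_summable_cost R (ball_type d r) (tower k) 12%:R^-1%R (@tower_cost k) _
    (tower_summable_cost R k); first by rewrite invr_ge0.
  exists B => l ul; have := costB (map (@image_val _ _ _) l); rewrite big_map; apply.
  by rewrite map_inj_uniq//; exact: val_inj.
- by rewrite mulr_ge0// exprn_ge0// divr_ge0.
- exact: ler0n.
- move=> g; have [w ws wg] := (ballP _ g).1 (leqnn (word_length g)).
  have costw := costC w; rewrite -image_val_word in costw.
  rewrite -[word_eval _ w]/(word_eval (@mg_gen d ball_marked) w) wg -/(cost g) in costw.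
  have e10 : (0 < 10%:R ^+ k :> R)%R by rewrite exprn_gt0.
  have : ((10 ^ k * cost g)%N%:R <=
      (9 ^ k * (#|ball_type d r| * 70) * word_length g + C)%N%:R :> R)%R.
    by rewrite ler_nat (leq_trans costw)// leq_add2r leq_mul2l ws orbT.
  rewrite natrD !natrM !natrX => h.
  rewrite -(ler_pM2l e10); apply: le_trans h _.
  rewrite /ball_rate expr_div_n natrM.
  move: (9%:R ^+ k)%R (#|_|%:R)%R ((word_length g)%:R)%R => n A len.
  have -> : (10%:R ^+ k * (n / 10%:R ^+ k * (A * 70%:R) * len + C%:R) =
      n * (A * 70%:R) * len + 10%:R ^+ k * C%:R)%R by field; rewrite lt0r_neq0.
  by rewrite lerD2l ler_peMl// exprn_ege1// ler1n.
- exact: marked_mass_function.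
- exact: le_trans (marked_moment mu ball_marked) muL.
Qed.

Hypotheses (r_gt0 : (0 < r)%N) (i01 : i0 != i1).

Lemma ball_marked_faithful (x : free_group d) : (size (fg_word x) <= r)%N ->
  marking ball_marked x = 1%g -> x = 1%g.
Proof.
move=> xr x1; apply: val_inj; apply: (@ball_faithful d r k i0 i1) => //.
  exact: fg_reduced.
rewrite -image_val_word -[1%g](image_val1 (@ball_gen d r k i0 i1)).
by rewrite -x1.
Qed.

Lemma ball_marked_neq1 : marking ball_marked (fg_gen i0) <> 1%g.
Proof. by move=> /ball_marked_faithful => /(_ r_gt0) /(congr1 (@fg_word d)). Qed.

Lemma ball_marked_normal (N : set ball_marked) :
  is_subgroup N -> is_normal N -> amenable R N -> N = [set 1%g].
Proof. exact: (@image_normal_trivial _ _ _ R N (@ball_values_rigid d r k i0 i1 r_gt0 i01 R)). Qed.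

Lemma ball_marked_not_amenable : ~ amenable R [set: ball_marked].
Proof.
move=> aM; have sgT : is_subgroup [set: ball_marked] by apply/is_subgroupP; split.
have nT : is_normal [set: ball_marked] by [].
apply: ball_marked_neq1.
suff : [set 1%g] (marking ball_marked (fg_gen i0)) by [].
by rewrite -(ball_marked_normal sgT nT aM).
Qed.

Lemma ball_marked_countable :
  countable [set H : set ball_marked | is_subgroup H /\ amenable R H].
Proof.
apply: countable_amenable_subgroups; apply: image_amenable_fg.
by apply: wreath_amenable_fg; exact: tower_amenable_fg.
Qed.

End BallMarked.

Lemma ball_rate_small (R : realType) d r (e : R) : (0 < e)%R ->
  exists k, (ball_rate R d r k <= e)%R.
Proof.
move=> e0; have A0 : (0 < (#|ball_type d r| * 70).+1%:R :> R)%R by rewrite ltr0n.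
have geom : ((9 / 10 : R) ^+ k)%R @[k --> \oo] --> (0 : R)%R.
  by apply: cvg_expr; rewrite ger0_norm; lra.
have eA0 : (0 < e / (#|ball_type d r| * 70).+1%:R)%R by rewrite divr_gt0.
move/cvgrPdist_le: geom => /(_ _ eA0)[k _ /(_ k (leqnn k))] /=.
have q0 : (0 <= 9 / 10 :> R)%R by lra.
rewrite sub0r normrN ger0_norm ?exprn_ge0// ler_pdivlMr// => ke; exists k.
apply: le_trans ke; rewrite /ball_rate ler_wpM2l ?ler_nat ?exprn_ge0//.
Qed.

Theorem proposition1p2 (R : realType) (d : nat) (d_ge2 : (2 <= d)%N)
    (mu : probability (free_group d) R) :
  non_degenerate mu -> finite_first_moment mu ->
  exists Gamma : nat -> marked_group d,
    [/\ marked_cvg Gamma (free_marked_group d),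
        (forall n, cvgn (entropy_rate (@marked_mass R d mu (Gamma n)))) /\
        asymptotic_entropy mu (Gamma n) @[n --> \oo] --> (0 : \bar R)%E &
        forall n : nat,
          [/\ ~ amenable R [set: Gamma n],
              forall N : set (Gamma n), is_subgroup N -> is_normal N ->
                amenable R N -> N = [set 1%g] &
              countable [set H : set (Gamma n) | is_subgroup H /\ amenable R H]]].
Proof.
move=> _ fin_mu.
pose i0 : 'I_d := Ordinal (ltnW d_ge2); pose i1 : 'I_d := Ordinal d_ge2.
have i01 : i0 != i1 by [].
pose S := esum setT (fun x : free_group d =>
  (word_length (x : free_marked_group d))%:R%:E * mu [set x])%E.
have S0 : (0 <= S)%E by apply: esum_ge0 => x _; rewrite mule_ge0// lee_fin.
have SE : S = (fine S)%:E by rewrite fineK// ge0_fin_numE.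
pose radius n := n.*2.+1.
have depth n : exists k, (ball_rate R d (radius n) k <= harmonic n)%R.
  by apply: ball_rate_small; rewrite invr_gt0.
have [k kP] := choice depth.
pose Gamma n := ball_marked (radius n) (k n) i0 i1.
pose c : R := (- ln (12%:R^-1) * fine S)%R.
have c0 : (0 <= c)%R.
  by rewrite mulr_ge0 ?fine_ge0// oppr_ge0 ln_le0// invf_le1// ler1n.
have entropy n : exists l : R, [/\ (0 <= l)%R, (l <= c * harmonic n)%R &
    entropy_rate (@marked_mass R d mu (Gamma n)) m @[m --> \oo] --> l%:E].
  have [|l [l0 lS hl]] := @ball_marked_entropy R d (radius n) (k n) i0 i1 mu (fine S).
    by rewrite -SE.
  exists l; split => //; apply: le_trans lS _; rewrite mulrAC ler_wpM2l//; exact: kP.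
have [l lP] := choice entropy.
exists Gamma; split.
- apply/marked_cvgP => r; exists r => // n /= rn.
  apply: (@ball_iso_le _ r n) => //; apply: free_ball_iso => x xn.
  exact: ball_marked_faithful.
- split=> [n|]; first by case: (lP n) => _ _ hl; apply/cvg_ex; exists (l n)%:E.
  have -> : (fun n => asymptotic_entropy mu (Gamma n)) = (fun n => (l n)%:E).
    by apply: funext => n; case: (lP n) => _ _ hl; exact: cvg_lim hl.
  have l_cvg : l n @[n --> \oo] --> (0 : R)%R.
    apply: (@squeeze_cvgr _ _ _ _ (fun=> 0%R) (fun n => (c * harmonic n)%R)).
    + by near=> n; case: (lP n) => -> -> _.
    + exact: cvg_cst.
    + rewrite -(mulr0 c); apply: cvgM; [exact: cvg_cst|exact: cvg_harmonic].
  exact: (cvg_comp _ _ l_cvg).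
- move=> n; split.
  + exact: ball_marked_not_amenable.
  + exact: ball_marked_normal.
  + exact: ball_marked_countable.
Unshelve. all: by end_near. Qed.
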